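(* Let $\sigma>0$, $k\ge0$, and consider a probability measure $\mu$ on $\mathbb R_+=[0,\infty)$. Then, for the infinite volume ABEP$(\sigma,k)$ on $\mathbb Z$ initialized with the homogeneous product measure with marginals $\mu$, we have $$\mathbb E^{\otimes\mu}\big[e^{-2\sigma J_i(t)}\big]=\mathbf P_0\big[\ell(t)=0\big]+\mathbf E_0\Big[\big(\lambda_+^{\ell(t)}+\lambda_-^{\ell(t)}\big)\mathbf 1_{\ell(t)\ge1}\Big],$$ where $\lambda_\pm:=\int\mu(dy)\,e^{\pm2\sigma y}$ and $\ell(t)$ is the continuous time symmetric random walk on $\mathbb Z$ jumping at rate $2k$ (to each of its two neighbours), with $\mathbf P_0,\mathbf E_0$ referring to the walk started at $0$. In particular we have $$\lim_{t\to\infty}\frac1t\log\mathbb E^{\otimes\mu}\big[e^{-2\sigma J_i(t)}\big]=\sup_{x\ge0}\{x\log\lambda_+-\mathcal I(x)\}-\inf_{x\ge0}\mathcal I(x)$$ with $$\mathcal I(x)=4k-\sqrt{x^2+(4k)^2}+x\log\Big\{\frac1{4k}\Big[x+\sqrt{x^2+(4k)^2}\Big]\Big\}.$$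
   Context: The law of the walk is $\mathbf P_0(\ell(t)=n)=e^{-4kt}I_{|n|}(4kt)$, with $I_n$ the modified Bessel function. ABEP$(\sigma,k)$ (asymmetric Brownian energy process) on $\mathbb Z$ is the Markov process on configurations $x\in\mathbb R_+^{\mathbb Z}$ with generator $\sum_{i\in\mathbb Z}\mathcal L_{i,i+1}$, where $$\mathcal L_{i,i+1}f(x)=\tfrac1{4\sigma^2}(1-e^{-2\sigma x_i})(e^{2\sigma x_{i+1}}-1)\Big(\tfrac{\partial}{\partial x_i}-\tfrac{\partial}{\partial x_{i+1}}\Big)^2f(x)-\tfrac1{2\sigma}\Big\{(1-e^{-2\sigma x_i})(e^{2\sigma x_{i+1}}-1)+2k\big(2-e^{-2\sigma x_i}-e^{2\sigma x_{i+1}}\big)\Big\}\Big(\tfrac{\partial}{\partial x_i}-\tfrac{\partial}{\partial x_{i+1}}\Big)f(x).$$ For $L\in\mathbb N$ let $x^{(L)}$ be the restriction of $x$ to $[-L,L]$ (equal to $x_i$ for $i\in[-L,L]$ and $0$ otherwise), and for configurations of finite total energy let $E_i(x)=\sum_{\ell\ge i}x_\ell$. The total integrated current $J_i(t)$ in $[0,t]$ is the total energy crossing the bond $(i-1,i)$ in the right direction, $$J_i(t)=E_i(x(t))-E_i(x(0)):=\lim_{L\to\infty}\big(E_i(x^{(L)}(t))-E_i(x^{(L)})\big),$$ and infinite-volume expectations are understood through this limiting procedure, i.e. as limits as $L\to\infty$ of expectations for the process started from $x^{(L)}$. Finally, with $\mathbb E_x$ the expectation for the process started from $x$, $$\mathbb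 E^{\otimes\mu}[f(x(t))]=\int\Big(\bigotimes_{i\in\mathbb Z}\mu(dx_i)\Big)\,\mathbb E_x[f(x(t))].$$ *)

(* Defs.v *)
From HB Require Import structures.
From mathcomp Require Import all_boot all_order all_algebra.
From mathcomp Require Import all_classical all_reals all_analysis.

Set Implicit Arguments.
Unset Strict Implicit.
Unset Printing Implicit Defensive.

Import Order.TTheory GRing.Theory Num.Theory.
Import numFieldNormedType.Exports.

Local Open Scope classical_set_scope.
Local Open Scope ring_scope.

HB.instance Definition _ := isPointed.Build int 0.
HB.instance Definition _ := @isMeasurable.Build default_measure_display
  int discrete_measurable discrete_measurable0
  discrete_measurableC discrete_measurableU.

(* A time-homogeneous Markov process with state space S (a subset of T) is
   given by its transition probabilities P (t, x) = law of the process at time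
   t >= 0 started from x. Being a kernel on R * T, P is jointly measurable in
   (t, x). The values P (t, x) with t < 0 or x outside S are irrelevant. *)
Section markov.
Context {d : measure_display} {T : measurableType d} {R : realType}.
Variables (S : set T) (P : R.-pker (measurableTypeR R * T) ~> T).

Definition markov_process : Prop :=
  [/\ forall x (A : set T), S x -> measurable A -> P (0, x) A = \d_x A,
      forall s t x (A : set T), 0 <= s -> 0 <= t -> S x -> measurable A ->
        P (s + t, x) A = (\int[P (s, x)]_y P (t, y) A)%E
    & forall t x, 0 <= t -> S x -> {ae P (t, x), forall y, S y}].

(* (f, g) belongs to the full generator (in the sense of Ethier and Kurtz):
   E_x[f(x(t))] = f(x) + \int_0^t E_x[g(x(s))] ds. *)
Definition full_generator (f g : T -> R) : Prop :=
  forall t x, 0 <= t -> S x ->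
    (\int[P (t, x)]_y (f y)%:E =
     (f x)%:E + \int[lebesgue_measure]_(s in `[0%R, t])
                  \int[P (s, x)]_y (g y)%:E)%E.

End markov.

Section walk.
Context {R : realType}.

Definition walk_generator (k : R) (f : int -> R) : int -> R :=
  fun n => 2 * k * (f (n + 1) - f n) + 2 * k * (f (n - 1) - f n).

Definition symmetric_walk (k : R)
    (W : R.-pker (measurableTypeR R * int) ~> int) : Prop :=
  markov_process setT W /\
  forall f : int -> R, (exists M : R, forall n, `|f n| <= M) ->
    full_generator setT W f (walk_generator k f).

End walk.

Section configurations.
Variable R : realType.

Definition coordinate_sets : set (set (int -> R)) :=
  [set A | exists (i : int) (B : set R),
     measurable B /\ A = [set x | B (x i)]].

(* R^Z with the product sigma-algebra *)
Definition config := g_sigma_algebraType coordinate_sets.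

End configurations.

Section product_measure.
Context {R : realType}.

Definition is_product_measure (mu : probability (measurableTypeR R) R)
    (Q : probability (config R) R) : Prop :=
  forall (s : seq int) (A : int -> set R), uniq s ->
    (forall i, measurable (A i)) ->
    Q [set x : config R | forall i, i \in s -> A i (x i)] =
    (\prod_(i <- s) mu (A i))%E.

End product_measure.

Section abep.
Context {R : realType}.
Implicit Types (x y : config R) (f : config R -> R) (i : int).

Definition nonneg_config : set (config R) := [set x | forall i, 0 <= x i].

Definition total_energy x : \bar R := (\esum_(i in [set: int]) (x i)%:E)%E.

Definition finite_energy : set (config R) :=
  [set x | nonneg_config x /\ (total_energy x < +oo)%E].

Definition energy_from i x : R :=
  fine (\esum_(l in [set l : int | (i <= l)%R]) (x l)%:E)%E.

Definition shift_coord i (h : R) x : config R :=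
  fun j => if j == i then x j + h else x j.

Definition partial i f x : R := derive1 (fun h : R => f (shift_coord i h x)) 0.

Definition bond_derivative i f : config R -> R :=
  fun x => partial i f x - partial (i + 1) f x.

Definition bond_generator (sigma k : R) i f : config R -> R := fun x =>
  let a := 1 - expR (- (2 * sigma * x i)) in
  let b := expR (2 * sigma * x (i + 1)) - 1 in
  (4 * sigma ^+ 2)^-1 * (a * b) * bond_derivative i (bond_derivative i f) x
  - (2 * sigma)^-1 *
    (a * b +
     2 * k * (2 - expR (- (2 * sigma * x i)) - expR (2 * sigma * x (i + 1))))
    * bond_derivative i f x.

(* For a function of finitely many coordinates only finitely many terms of
   this sum are nonzero. *)
Definition abep_generator (sigma k : R) f : config R -> R :=
  fun x => \sum_(i \in [set: int]) bond_generator sigma k i f x.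

Definition is_C1 n (F : 'rV[R]_n.+1 -> R) : Prop :=
  forall v, (forall p, derivable F p v) /\ continuous ('D_v F).

Definition is_C2 n (F : 'rV[R]_n.+1 -> R) : Prop :=
  is_C1 F /\ forall v, is_C1 ('D_v F).

Definition C2_cylinder f : Prop :=
  exists (n : nat) (a : int) (F : 'rV[R]_n.+1 -> R),
    is_C2 F /\ forall x, f x = F (\row_(j < n.+1) x (a + j%:Z)).

(* ABEP(sigma, k) on Z started from configurations of finite total energy: the
   dynamics only exchanges energy between neighbouring sites, so the total
   energy is conserved. *)
Definition is_abep (sigma k : R)
    (P : R.-pker (measurableTypeR R * config R) ~> config R) : Prop :=
  [/\ markov_process finite_energy P,
      forall t x, 0 <= t -> finite_energy x ->
        {ae P (t, x), forall y, total_energy y = total_energy x}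
    & forall f, C2_cylinder f ->
        full_generator finite_energy P f (abep_generator sigma k f)].

Definition restriction (L : nat) x : config R :=
  fun i => if `|i| <= L%:Z then x i else 0.

Section current.
Variables (sigma : R) (P : R.-pker (measurableTypeR R * config R) ~> config R).

(* E_x[e^{- 2 sigma J_i(t)}] for x of finite total energy *)
Definition current_exp_finite i (t : R) x : \bar R :=
  (\int[P (t, x)]_y
     (expR (- (2 * sigma * (energy_from i y - energy_from i x))))%:E)%E.

(* the same for an arbitrary initial configuration, as the limit of the
   expectations for the process started from the restrictions x^(L) *)
Definition current_exp i (t : R) x : \bar R :=
  limn (fun L => current_exp_finite i t (restriction L x)).

Definition current_exp_product (Q : probability (config R) R) i (t : R) :
    \bar R :=
  (\int[Q]_(x in nonneg_config) current_exp i t x)%E.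

End current.

Definition exp_moment (mu : probability (measurableTypeR R) R) (c : R) :
    \bar R :=
  (\int[mu]_y (expR (c * y))%:E)%E.

(* For k = 0 the closed formula is read with 1 / 0 = +oo (the limit k -> 0),
   i.e. 0 at x = 0 and +oo at x > 0; this is the rate function of the walk
   that never moves. *)
Definition rate (k x : R) : \bar R :=
  if k == 0 then (if x == 0 then 0%E else +oo%E)
  else (4 * k - Num.sqrt (x ^+ 2 + (4 * k) ^+ 2)
        + x * ln ((4 * k)^-1 * (x + Num.sqrt (x ^+ 2 + (4 * k) ^+ 2))))%:E.

End abep.

(* Main.v *)
(* For the energy E_i to the right of the bond (i - 1, i), put
   F_i = exp (- 2 sigma E_i). The ABEP generator acts on these functions as the
   generator of the walk acts on the index:
     L F_i = 2k (F_(i+1) + F_(i-1) - 2 F_i).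
   As E_i involves infinitely many sites, L is first applied to the truncations
   exp (- 2 sigma (x_i + ... + x_(i+n))); the extra boundary term at i + n is
   bounded and vanishes as n tends to infinity. Hence, for x of finite energy,
   both E_x[F_i(x(t))] and E_0[F_(i+l(t))(x)] are bounded solutions of the
   discrete heat equation started from F_i(x), and such solutions are unique:
   iterating the integral equation n times leaves a remainder of order
   (8kt)^n / n!. Dividing by F_i(x) gives E_x[exp (- 2 sigma J_i(t))] as the
   mean over l(t) of the exponential of 2 sigma times the signed energy between
   i and i + l(t), which passes to the limit along the restrictions of x (by
   monotone convergence for l(t) >= 0, dominated convergence for l(t) < 0).
   Averaging over the product measure yields lambda_+^l or lambda_-^|l|, and
   the symmetry of the walk gives the formula.

   Since lambda_- and 1 / lambda_+ lie in [0, 1], the formula agrees up to a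
   factor 2 with E_0[lambda_+^l(t)] = exp (2k (lambda_+ + 1 / lambda_+ - 2) t),
   and that exponent is the Legendre transform of the rate function at
   log lambda_+. *)

From HB Require Import structures.
From mathcomp Require Import all_boot all_order all_algebra.
From mathcomp Require Import all_classical all_reals all_analysis.
From mathcomp Require Import measurable_realfun ring lra zify.
Require Import Defs.

Set Implicit Arguments.
Unset Strict Implicit.
Unset Printing Implicit Defensive.

Import Order.TTheory GRing.Theory Num.Theory.
Import numFieldNormedType.Exports.

Local Open Scope classical_set_scope.
Local Open Scope ring_scope.

(** * Iterated integral inequalities *)

Lemma Rintegral_scaled_power (R : realType) (c t : R) m : 0 <= t ->
  \int[lebesgue_measure]_(s in `[0, t]) (c * (s ^+ m / m`!%:R)) =
  c * (t ^+ m.+1 / m.+1`!%:R).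
Proof.
rewrite le_eqVlt => /predU1P[<-|t0].
  by rewrite set_itv1 Rintegral_set1 expr0n/= mul0r mulr0.
pose F (s : R) := c * (s ^+ m.+1 / m.+1`!%:R).
pose f (s : R) := c * (s ^+ m / m`!%:R).
have dF (x : R) : is_derive x 1 F (f x).
  rewrite (_ : F = (c / m.+1`!%:R) \*: (@id R) ^+ m.+1); last first.
    apply/funext => s; rewrite /F.
    rewrite -[RHS]/(c / m.+1`!%:R * (id ^+ m.+1) s) exprfctE.
    by rewrite -mulrA [_ * s ^+ _]mulrC.
  apply: is_derive_eq; rewrite scaler1 /f factS natrM /GRing.scale/=.
  by rewrite -mulrA invfM mulrACA mulVf ?pnatr_eq0// mul1r [_^-1 * _]mulrC.
have cf : continuous f.
  move=> x; rewrite /f; apply: cvgM; first exact: cvg_cst.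
  by apply: cvgM; [exact: exprn_continuous|exact: cvg_cst].
have cF : continuous F.
  by move=> x; apply/differentiable_continuous/derivable1_diffP; case: (dF x).
rewrite /Rintegral (@continuous_FTC2 _ f F 0 t)//.
- by rewrite -EFinB/= /F expr0n/= mul0r mulr0 subr0.
- exact: continuous_subspaceT.
- split; last 2 first.
  + exact: cvg_at_right_filter (cF _).
  + exact: cvg_at_left_filter (cF _).
  by move=> x _; case: (dF x).
- by move=> x _; rewrite derive1E; case: (dF x).
Qed.

(** Substituting the inequality for [z n.+1] into that for [z n] repeatedly produces a Taylor
    polynomial with coefficients [c m] and a remainder controlled by [b n]. When [b] grows
    geometrically the remainder tends to 0, so this serves both as Gronwall's inequality and as a
    uniqueness argument. The induction shifts all three sequences by one. *)
Lemma taylor_upper (R : realType) (z : nat -> R -> R) (c b : nat -> R) :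
  (forall (n : nat) (t : R), 0 <= t ->
     (@lebesgue_measure R).-integrable `[0, t] (EFin \o z n)) ->
  (forall (n : nat) (t : R), 0 <= t ->
     z n t <= c n + \int[lebesgue_measure]_(s in `[0, t]) z n.+1 s) ->
  (forall (n : nat) (t : R), 0 <= t -> z n t <= b n) ->
  forall (n : nat) (t : R), 0 <= t ->
    z 0 t <= \sum_(m < n) c m * (t ^+ m / m`!%:R) + b n * (t ^+ n / n`!%:R).
Proof.
move=> + + + n; elim: n z c b => [|n IH] z c b iz zc zb t t0.
  by rewrite big_ord0 add0r expr0 divr1 mulr1 zb.
rewrite big_ord_recl/= expr0 divr1 mulr1 -addrA.
apply: le_trans (zc 0 t t0) _; rewrite lerD2l.
have ipow (a : R) m :
    (@lebesgue_measure R).-integrable `[0, t]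
      (EFin \o (fun s => a * (s ^+ m / m`!%:R))).
  apply: continuous_compact_integrable; first exact: segment_compact.
  apply: continuous_subspaceT => x; apply: cvgM; first exact: cvg_cst.
  by apply: cvgM; [exact: exprn_continuous|exact: cvg_cst].
have isum (p : nat) : (@lebesgue_measure R).-integrable `[0, t]
    (EFin \o (fun s => \sum_(m < p) c m.+1 * (s ^+ m / m`!%:R))).
  elim: p => [|p IHp].
    rewrite (_ : _ \o _ = cst 0%E); first exact: integrable0.
    by apply/funext => s /=; rewrite big_ord0.
  rewrite (_ : _ \o _ = fun s : R => (
    (\sum_(m < p) c m.+1 * (s ^+ m / m`!%:R))%:E +
    (c p.+1 * (s ^+ p / p`!%:R))%:E)%E); first by apply: integrableD => //; exact: ipow.
  by apply/funext => s /=; rewrite big_ord_recr.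
(* The remaining terms are the integral of the bound for the shifted sequences, so the induction
   hypothesis applies under the integral sign. *)
have -> : \sum_(i < n) c (bump 0 i) * (t ^+ bump 0 i / (bump 0 i)`!%:R) +
    b n.+1 * (t ^+ n.+1 / n.+1`!%:R) = \int[lebesgue_measure]_(s in `[0, t])
      (\sum_(m < n) c m.+1 * (s ^+ m / m`!%:R) + b n.+1 * (s ^+ n / n`!%:R)).
  rewrite RintegralD// Rintegral_scaled_power//; congr (_ + _).
  elim: n {IH} => [|p IHp].
    by rewrite big_ord0 (@eq_Rintegral _ _ _ _ _ (cst 0)) ?Rintegral_cst ?mul0r//
       => s _; rewrite big_ord0.
  under eq_Rintegral do rewrite big_ord_recr/=.
  rewrite big_ord_recr/= IHp RintegralD//; last exact: isum.
  by rewrite Rintegral_scaled_power.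
apply: le_Rintegral => //=.
- exact: iz.
- rewrite (_ : _ \o _ = fun s : R => (
    (\sum_(m < n) c m.+1 * (s ^+ m / m`!%:R))%:E +
    (b n.+1 * (s ^+ n / n`!%:R))%:E)%E)//.
  by apply: integrableD => //; [exact: isum|exact: ipow].
- move=> s; rewrite in_itv/= => /andP[s0 _].
  by apply: (IH (fun n => z n.+1) (fun n => c n.+1) (fun n => b n.+1)) => // m u;
    [exact: iz|exact: zc|exact: zb].
Qed.

Lemma cvg_series_scaled_exp (R : realType) (a t : R) :
  (fun n => \sum_(m < n) a ^+ m * (t ^+ m / m`!%:R)) @ \oo --> expR (a * t).
Proof.
rewrite (_ : (fun n => _) = series (exp_coeff (a * t))).
  exact: is_cvg_series_exp_coeff.
apply/funext => n; rewrite /series/= big_mkord; apply: eq_bigr => m _.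
by rewrite /exp_coeff/= exprMn mulrA.
Qed.

Lemma cvg_scaled_exp_coeff (R : realType) (b a t : R) :
  (fun n => b * a ^+ n * (t ^+ n / n`!%:R)) @ \oo --> 0.
Proof.
rewrite -(mulr0 b) (_ : (fun n => _) = (fun n => b * exp_coeff (a * t) n)).
  by apply: cvgMr; exact: cvg_exp_coeff.
by apply/funext => n; rewrite /exp_coeff/= exprMn !mulrA.
Qed.

Lemma integral_system_eq0 (R : realType) (z : nat -> R -> R) (K C : R) :
  (forall (n : nat) (t : R), 0 <= t ->
     (@lebesgue_measure R).-integrable `[0, t] (EFin \o z n)) ->
  (forall (n : nat) (t : R), 0 <= t ->
     z n t = \int[lebesgue_measure]_(s in `[0, t]) z n.+1 s) ->
  (forall (n : nat) (t : R), 0 <= t -> `|z n t| <= K * C ^+ n) ->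
  forall t : R, 0 <= t -> z 0%N t = 0.
Proof.
move=> iz ze zK t t0.
have le0 (y : nat -> R -> R) :
    (forall (n : nat) (t : R), 0 <= t ->
     (@lebesgue_measure R).-integrable `[0, t] (EFin \o y n)) ->
    (forall (n : nat) (t : R), 0 <= t ->
     y n t = \int[lebesgue_measure]_(s in `[0, t]) y n.+1 s) ->
    (forall (n : nat) (t : R), 0 <= t -> y n t <= K * C ^+ n) -> y 0%N t <= 0.
  move=> iy ye yK.
  apply: (ler_cvg_to (cvg_cst _) (@cvg_scaled_exp_coeff R K C t)).
  apply: nearW => n /=.
  have := @taylor_upper _ y (fun=> 0) (fun n => K * C ^+ n) iy _ yK n t t0.
  rewrite big1 ?add0r => [|i _]; last by rewrite mul0r.
  by apply => m u u0; rewrite add0r -ye.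
apply/eqP; rewrite eq_le -[X in _ && X]oppr_le0; apply/andP; split.
  by apply: le0 => // n u u0; rewrite (le_trans (ler_norm _))// zK.
apply: (le0 (fun n s => - z n s)) => [n u u0|n u u0|n u u0].
- rewrite (_ : _ \o _ = (fun s => - (z n s)%:E)%E)//.
  exact: integrableN (iz n u u0).
- rewrite ze// -mulN1r -RintegralZl//; last exact: iz.
  by apply: eq_Rintegral => s _; rewrite mulN1r.
- by rewrite (le_trans (ler_norm _))// normrN zK.
Qed.

(** * Bounded solutions of the discrete heat equation *)

(** The generator is a sum of four terms, each at most [2 * k * M] in absolute value. *)
Lemma walk_generator_bound (R : realType) (k M : R) (f : int -> R) n :
  0 <= k -> (forall n, `|f n| <= M) -> `|walk_generator k f n| <= 8 * k * M.
Proof.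
move=> k0 fM; rewrite /walk_generator ler_norml.
have := fM n; have := fM (n + 1); have := fM (n - 1).
rewrite !ler_norml => /andP[a1 a2] /andP[b1 b2] /andP[c1 c2].
apply/andP; split; nra.
Qed.

Lemma measurable_walk_generator d (T : measurableType d) (R : realType) (k : R)
    (u : int -> T -> R) :
  (forall i, measurable_fun setT (u i)) ->
  forall i, measurable_fun setT (fun t => walk_generator k (u ^~ t) i).
Proof.
move=> mu i; rewrite /walk_generator.
by apply: measurable_funD; apply: measurable_funM => //; apply: measurable_funB.
Qed.

Lemma bounded_integrable_itv (R : realType) (f : R -> R) (M t : R) :
  measurable_fun setT f -> (forall s : R, 0 <= s -> `|f s| <= M) ->
  (@lebesgue_measure R).-integrable `[0, t] (EFin \o f).
Proof.
move=> mf fM; apply: (@le_integrable _ _ _ _ _ _ _ (cst M%:E)) => //.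
- by apply/measurable_EFinP; apply: measurable_funS mf.
- move=> s /=; rewrite in_itv/= => /andP[s0 _].
  by rewrite lee_fin (le_trans _ (ler_norm M))// fM.
- rewrite -[cst _]/(EFin \o cst M).
  apply: continuous_compact_integrable; first exact: segment_compact.
  by apply: continuous_subspaceT => x; exact: cvg_cst.
Qed.

(** The heat equation with initial datum [c] in integrated form, which is what a full generator
    provides directly; no derivative in time appears. The bound is uniform in both space and
    time. *)
Definition heat_solution (R : realType) (k : R) (c : int -> R) (u : int -> R -> R) :=
  [/\ forall i, measurable_fun setT (u i),
      exists M : R, forall (i : int) (t : R), 0 <= t -> `|u i t| <= M
    & forall (i : int) (t : R), 0 <= t -> u i t =
        c i + \int[lebesgue_measure]_(s in `[0, t]) walk_generator k (u ^~ s) i].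

Lemma walk_generatorB (R : realType) (k : R) (f g : int -> R) i :
  walk_generator k (fun j => f j - g j) i =
  walk_generator k f i - walk_generator k g i.
Proof. by rewrite /walk_generator; ring. Qed.

Lemma Rintegral_walk_generator (R : realType) (k t : R) (v : int -> R -> R) i :
  (forall j, (@lebesgue_measure R).-integrable `[0, t] (EFin \o v j)) ->
  \int[lebesgue_measure]_(s in `[0, t]) walk_generator k (v ^~ s) i =
  walk_generator k (fun j => \int[lebesgue_measure]_(s in `[0, t]) v j s) i.
Proof.
move=> iv; rewrite /walk_generator.
have iB j j' : (@lebesgue_measure R).-integrable `[0, t]
    (EFin \o (fun s => v j s - v j' s)).
  rewrite (_ : _ \o _ = fun s => ((v j s)%:E - (v j' s)%:E)%E)//.
  by apply: integrableB => //; exact: iv.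
have iZ j j' : (@lebesgue_measure R).-integrable `[0, t]
    (EFin \o (fun s => 2 * k * (v j s - v j' s))).
  rewrite (_ : _ \o _ = fun s => ((2 * k)%:E * (v j s - v j' s)%:E)%E)//.
  by apply: integrableZl => //; exact: iB.
by rewrite RintegralD// !RintegralZl// !RintegralB//.
Qed.

(** Let [d n] be the [n]-th iterate of the generator on the difference of the solutions. The
    generator is a finite linear combination, so it commutes with the time integral and [d n] is the
    integral of [d n.+1]; each iteration costs a factor [8 * k] in the bound. *)
Lemma heat_unique (R : realType) (k : R) (c : int -> R) (u v : int -> R -> R) :
  0 <= k -> heat_solution k c u -> heat_solution k c v ->
  forall (i : int) (t : R), 0 <= t -> u i t = v i t.
Proof.
move=> k0 [mu [Mu uM] eu] [mv [Mv vM] ev] i t t0.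
pose d n j s := iter n (walk_generator k) (fun j => u j s - v j s) j.
have md n : forall j, measurable_fun setT (d n j).
  elim: n => [|n IH] j; first exact: measurable_funB.
  exact: (measurable_walk_generator k IH j).
have dM n j (s : R) : 0 <= s -> `|d n j s| <= (Mu + Mv) * (8 * k) ^+ n.
  move=> s0; elim: n j => [|n IH] j.
    by rewrite expr0 mulr1 (le_trans (ler_normB _ _))// lerD// ?uM ?vM.
  rewrite exprS mulrCA; exact: walk_generator_bound.
have id n j s : (@lebesgue_measure R).-integrable `[0, s] (EFin \o d n j).
  by apply: bounded_integrable_itv (md n j) _ => r; exact: dM.
have iA (w : int -> R -> R) (M : R) j (s : R) : (forall i, measurable_fun setT (w i)) ->
    (forall (i : int) (t : R), 0 <= t -> `|w i t| <= M) ->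
    (@lebesgue_measure R).-integrable `[0, s]
      (EFin \o (fun s => walk_generator k (w ^~ s) j)).
  move=> mw wM; apply: (@bounded_integrable_itv _ _ (8 * k * M)).
    exact: measurable_walk_generator.
  by move=> r r0; apply: walk_generator_bound => // m; exact: wM.
have de n : forall j (s : R), 0 <= s ->
    d n j s = \int[lebesgue_measure]_(r in `[0, s]) d n.+1 j r.
  elim: n => [|n IH] j s s0.
    rewrite /d/= eu// ev// opprD addrACA subrr add0r -RintegralB//.
    - by apply: eq_Rintegral => r _; rewrite -walk_generatorB.
    - exact: iA mu uM.
    - exact: iA mv vM.
  rewrite (_ : d n.+1 j s = walk_generator k (fun j => d n j s) j)//.
  rewrite [RHS](@Rintegral_walk_generator _ _ _ (d n.+1))//.
  by rewrite /walk_generator -!IH.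
apply/eqP; rewrite -subr_eq0; apply/eqP.
apply: (@integral_system_eq0 R (fun n => d n i) (Mu + Mv) (8 * k)) => //.
- by move=> n s s0; exact: de.
- by move=> n s; exact: dM.
Qed.

(** * Kernels and the symmetric walk *)

Lemma measurable_kernel_integral d d' (X : measurableType d)
    (Y : measurableType d') (R : realType) (l : R.-ker X ~> Y)
    (f : Y -> \bar R) : measurable_fun setT f ->
  measurable_fun setT (fun x => (\int[l x]_y f y)%E).
Proof.
move=> mf; rewrite (_ : (fun x => _) = fun x =>
  (\int[l x]_y (f^\+)%E y - \int[l x]_y (f^\-)%E y)%E); last first.
  by apply/funext => x; rewrite integralE.
apply: emeasurable_funB; apply: measurable_fun_integral_kernel => //.
- exact: measurable_kernel.
- exact: measurable_funepos.
- exact: measurable_kernel.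
- exact: measurable_funeneg.
Qed.

Section unit_mass.
Context d (T : measurableType d) (R : realType) (p : {measure set T -> \bar R}).
Hypothesis p1 : (p setT = 1)%E.

(** The bound is only almost sure because under [P (t, x)] the configuration is nonnegative, and
    hence the exponentials bounded, only almost surely. *)
Lemma integrable_ae_bounded (f : T -> R) (M : R) : measurable_fun setT f ->
  {ae p, forall y, `|f y| <= M} -> p.-integrable setT (EFin \o f).
Proof.
move=> mf fM; apply/integrableP; split; first exact/measurable_EFinP.
apply: (@le_lt_trans _ _ (\int[p]_y `|M|%:E)%E); last first.
  by rewrite integral_cst// p1 mule1 ltry.
apply: ae_ge0_le_integral => //.
  by apply/measurable_EFinP; apply: measurableT_comp.
by apply: filterS fM => y /= fy _; rewrite lee_fin (le_trans fy)// ler_norm.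
Qed.

Lemma normr_Rintegral_le (f : T -> R) (M : R) : measurable_fun setT f ->
  {ae p, forall y, `|f y| <= M} -> `|\int[p]_y f y| <= M.
Proof.
move=> mf fM; have ifM := integrable_ae_bounded mf fM.
(* A negative bound would make the whole space negligible, against total mass one. *)
have M0 : (0 <= M)%R.
  apply: contrapT => /negP; rewrite -ltNge => M0.
  have [N [mN N0 sN]] := fM.
  have : (p setT <= p N)%E.
    apply: le_measure; rewrite ?inE// => y _; apply: sN => /= fy.
    by have := le_lt_trans (normr_ge0 (f y)) (le_lt_trans fy M0); rewrite ltxx.
  by rewrite p1 N0 lee_fin ler10.
rewrite (le_trans (le_normr_Rintegral _ ifM))//.
rewrite -lee_fin fineK; last first.
  by apply: integrable_fin_num => //; exact: integrable_norm ifM.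
rewrite (_ : M%:E = \int[p]_y M%:E)%E; last by rewrite integral_cst// p1 mule1.
apply: ae_ge0_le_integral => //.
  by apply/measurable_EFinP; apply: measurableT_comp.
by apply: filterS fM => y /= fy _; rewrite lee_fin.
Qed.

Lemma Rintegral_walk_generator_ae (k M : R) (f : int -> T -> R) i :
  (forall i, measurable_fun setT (f i)) ->
  (forall i, {ae p, forall y, `|f i y| <= M}) ->
  \int[p]_y walk_generator k (f ^~ y) i =
  walk_generator k (fun j => \int[p]_y f j y) i.
Proof.
move=> mf fM; rewrite /walk_generator.
have ifM j : p.-integrable setT (EFin \o f j).
  exact: integrable_ae_bounded (mf j) (fM j).
have iB j j' : p.-integrable setT (EFin \o (fun s => f j s - f j' s)).
  rewrite (_ : _ \o _ = fun s => ((f j s)%:E - (f j' s)%:E)%E)//.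
  by apply: integrableB => //; exact: ifM.
have iZ j j' : p.-integrable setT (EFin \o (fun s => 2 * k * (f j s - f j' s))).
  rewrite (_ : _ \o _ = fun s => ((2 * k)%:E * (f j s - f j' s)%:E)%E)//.
  by apply: integrableZl => //; exact: iB.
by rewrite RintegralD// !RintegralZl// !RintegralB//.
Qed.

End unit_mass.

Lemma discrete_measurable_fun d (T : measurableType d) (f : int -> T) :
  measurable_fun setT f.
Proof. by []. Qed.

Lemma measurable_kernel_time d (T : measurableType d) (R : realType)
    (K : R.-pker (measurableTypeR R * T) ~> T) (x : T) (f : T -> \bar R) :
  measurable_fun setT f ->
  measurable_fun setT (fun t : R => (\int[K (t, x)]_y f y)%E).
Proof.
move=> mf; apply: (measurableT_comp (f := fun s => (\int[K s]_y f y)%E)).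
  exact: measurable_kernel_integral.
exact: measurable_fun_pair.
Qed.

Lemma measurable_kernel_mean d (T : measurableType d) (R : realType)
    (K : R.-pker (measurableTypeR R * T) ~> T) (x : T) (f : T -> R) :
  measurable_fun setT f ->
  measurable_fun setT (fun t : R => \int[K (t, x)]_y f y).
Proof.
move=> mf; apply: measurableT_comp => //; apply: measurable_kernel_time.
exact/measurable_EFinP.
Qed.

Section walk_theory.
Context (R : realType) (k : R) (W : R.-pker (measurableTypeR R * int) ~> int).
Hypothesis k0 : 0 <= k.
Hypothesis walkW : symmetric_walk k W.

Let W1 s : (W s setT = 1)%E. Proof. exact: prob_kernel. Qed.

(** Real-valued form of the generator identity: as [f] and its image under the generator are
    bounded, every integral is finite and [fine] can be distributed. *)
Lemma walk_mean (f : int -> R) (M t : R) (n : int) :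
  (forall n, `|f n| <= M) -> 0 <= t ->
  \int[W (t, n)]_m f m = f n +
    \int[lebesgue_measure]_(s in `[0, t]) \int[W (s, n)]_m walk_generator k f m.
Proof.
move=> fM t0; case: walkW => _ /(_ f (ex_intro _ M fM) t n t0 I) E.
have AM m : `|walk_generator k f m| <= 8 * k * M by exact: walk_generator_bound.
have ifM s : (W (s, n)).-integrable setT (EFin \o f).
  apply: (@integrable_ae_bounded _ _ _ _ _ f M) => //.
  exact: aeW.
have iA s : (W (s, n)).-integrable setT (EFin \o walk_generator k f).
  apply: (@integrable_ae_bounded _ _ _ _ _ _ (8 * k * M)) => //.
  exact: aeW.
have iI : (@lebesgue_measure R).-integrable `[0, t]
    (EFin \o (fun s => \int[W (s, n)]_m walk_generator k f m)).
  apply: (@bounded_integrable_itv _ _ (8 * k * M)).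
    exact: measurable_kernel_mean.
  move=> s _; apply: normr_Rintegral_le => //.
  exact: aeW.
rewrite {1}/Rintegral E fineD//; last first.
- rewrite (@eq_integral _ _ _ _ _
    (fun s => (\int[W (s, n)]_m walk_generator k f m)%:E)%E).
    exact: integrable_fin_num iI.
  by move=> s _; rewrite fineK//; exact: integrable_fin_num.
congr (_ + _); rewrite [RHS]/Rintegral; congr fine.
by apply: eq_integral => s _; rewrite fineK//; exact: integrable_fin_num.
Qed.

(** The generator commutes with translations, so the generator identity from 0 for the translate of
    [f] by [i] gives the equation at [i]. *)
Lemma walk_heat_solution (f : int -> R) (M : R) :
  (forall n, `|f n| <= M) ->
  heat_solution k f (fun i t => \int[W (t, 0%R)]_m f (i + m)).
Proof.
move=> fM; split.
- by move=> i; exact: measurable_kernel_mean.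
- exists M => i t _; apply: normr_Rintegral_le => //.
  exact: aeW.
- move=> i t t0; rewrite (@walk_mean _ M)// addr0; congr (_ + _).
  apply: eq_Rintegral => s _.
  rewrite -(@Rintegral_walk_generator_ae _ _ _ _ _ _ M (fun i m => f (i + m)))//.
  + apply: eq_Rintegral => m _; rewrite /walk_generator.
    by rewrite !(addrAC i _ m) !addrA.

  + by move=> j; exact: aeW.
Qed.

(** The symmetry of the law comes from uniqueness: reflecting both the datum and the starting point
    gives a second solution with datum [f], since the reflection only swaps the two neighbours in
    the generator. The claim is the equality of the two solutions at 0. *)
Lemma walk_mean_opp (f : int -> R) (M t : R) :
  (forall n, `|f n| <= M) -> 0 <= t ->
  \int[W (t, 0%R)]_m f (- m) = \int[W (t, 0%R)]_m f m.
Proof.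
move=> fM t0.
have fNM n : `|f (- n)| <= M by [].
have [mu bu eu] := walk_heat_solution fNM.
have hN : heat_solution k f (fun i t => \int[W (t, 0%R)]_m f (- (- i + m))).
  split.
  - by move=> i; exact: measurable_kernel_mean.
  - by case: bu => K uK; exists K => i s s0; exact: uK.
  - move=> i s s0; apply: (etrans (eu (- i) s s0)).
    rewrite opprK; apply: congr1; apply: eq_Rintegral => r _.
    by rewrite /walk_generator addrC !(opprD, opprK).
have := heat_unique k0 hN (walk_heat_solution fM) 0 t0.
rewrite oppr0.
under eq_Rintegral do rewrite add0r.
by under [in RHS]eq_Rintegral do rewrite add0r.
Qed.

Lemma walk_symmetric (t : R) (A : set int) : 0 <= t ->
  W (t, 0%R) (-%R @^-1` A) = W (t, 0%R) A.
Proof.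
move=> t0.
have M1 n : `|\1_A n : R| <= 1.
  by rewrite indicE; case: (_ \in _); rewrite ?normr0 ?normr1.
have := walk_mean_opp M1 t0; rewrite /Rintegral.
have E (B : set int) : (\int[W (t, 0%R)]_m (\1_B m)%:E = W (t, 0%R) B)%E.
  by rewrite integral_indic// setIT.
under eq_integral.
  move=> m _; have -> : \1_A (- m) = \1_(-%R @^-1` A) m :> R.
    by rewrite !indicE.
  over.
rewrite !E.
have fin B : W (t, 0%R) B \is a fin_num.
  rewrite ge0_fin_numE//; apply: (@le_lt_trans _ _ 1%E); last exact: ltry.
  by rewrite -(W1 (t, 0%R)); apply: le_measure; rewrite ?inE.
by move=> e; rewrite -[LHS]fineK// e fineK.
Qed.

End walk_theory.

(** Carries the generator identity from approximations [f_ n] to a limit that need not lie in the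
    given domain. Dominated convergence is used under each [K s], with dominating function [h], and
    then in the time variable. It is applied to capped exponentials of the walk and to energies of
    finite segments. *)
Lemma kernel_equation_limit d (T : measurableType d) (R : realType)
    (K : R -> {measure set T -> \bar R}) (f_ g_ : nat -> T -> R)
    (f g h : T -> R) (c_ : nat -> R) (c B t : R) :
  (forall f : T -> \bar R, measurable_fun setT f ->
     measurable_fun setT (fun s => (\int[K s]_y f y)%E)) ->
  (forall n, measurable_fun setT (f_ n)) ->
  (forall n, measurable_fun setT (g_ n)) ->
  measurable_fun setT f -> measurable_fun setT g -> measurable_fun setT h ->
  (forall y, 0 <= h y) ->
  (forall s : R, 0 <= s <= t -> (\int[K s]_y (h y)%:E <= B%:E)%E) ->
  {ae K t, forall y n, `|f_ n y| <= h y} ->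
  {ae K t, forall y, f_ ^~ y @ \oo --> f y} ->
  (forall s : R, 0 <= s <= t -> {ae K s, forall y n, `|g_ n y| <= h y}) ->
  (forall s : R, 0 <= s <= t -> {ae K s, forall y, g_ ^~ y @ \oo --> g y}) ->
  c_ @ \oo --> c -> 0 <= t ->
  (forall n, \int[K t]_y (f_ n y)%:E = (c_ n)%:E +
     \int[lebesgue_measure]_(s in `[0%R, t]) \int[K s]_y (g_ n y)%:E)%E ->
  \int[K t]_y f y = c + \int[lebesgue_measure]_(s in `[0, t]) \int[K s]_y g y.
Proof.
move=> mK mf_ mg_ mf mg mh h0 hB f_h f_f g_h g_g c_c t0 E.
have ih s : 0 <= s <= t -> (K s).-integrable setT (EFin \o h).
  move=> st; apply/integrableP; split; first exact/measurable_EFinP.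
  apply: le_lt_trans (ltry B); apply: le_trans (hB s st).
  by under eq_integral do rewrite /= ger0_norm//.
have dct (u_ : nat -> T -> R) (u : T -> R) s : 0 <= s <= t ->
    (forall n, measurable_fun setT (u_ n)) -> measurable_fun setT u ->
    {ae K s, forall y n, `|u_ n y| <= h y} ->
    {ae K s, forall y, u_ ^~ y @ \oo --> u y} ->
    (K s).-integrable setT (EFin \o u) /\
    (\int[K s]_y (u_ n y)%:E @[n --> \oo] --> \int[K s]_y (u y)%:E)%E.
  move=> st mu_ mu u_h u_u.
  have [|||||] := @dominated_convergence _ _ _ (K s) setT measurableT
    (fun n y => (u_ n y)%:E) (EFin \o u) (EFin \o h).
  - by move=> n; exact/measurable_EFinP.
  - exact/measurable_EFinP.
  - apply: filterS u_u => y u_uy _.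
    by apply: cvg_EFin u_uy; apply: nearW.
  - exact: ih.
  - by apply: filterS u_h => y u_hy n _; rewrite lee_fin.
  - by [].
have tt : 0 <= t <= t by rewrite t0 lexx.
have [if_ cf] := dct f_ f t tt mf_ mf f_h f_f.
have bB (u : T -> R) s : 0 <= s <= t -> measurable_fun setT u ->
    {ae K s, forall y, `|u y| <= h y} -> (`|\int[K s]_y (u y)%:E| <= B%:E)%E.
  move=> st mu uh; apply: le_trans (hB s st).
  apply: le_trans (le_abse_integral _ _ _) _ => //; first exact/measurable_EFinP.
  apply: ae_ge0_le_integral => //.
  - by apply/measurable_EFinP; apply: measurableT_comp.
  - by move=> y _; rewrite lee_fin.
  - exact/measurable_EFinP.
  - by apply: filterS uh => y uhy _; rewrite lee_fin.
have iB : (@lebesgue_measure R).-integrable `[0, t] (cst B%:E).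
  rewrite -[cst _]/(EFin \o cst B).
  apply: continuous_compact_integrable; first exact: segment_compact.
  by apply: continuous_subspaceT => x; exact: cvg_cst.
(* In the time variable the domination is by the constant [B], which bounds the means of [h] on the
   whole time interval. *)
have [|||||iI _ cI] := @dominated_convergence _ _ _ (@lebesgue_measure R) `[0, t]
    (measurable_itv _) (fun n s => (\int[K s]_y (g_ n y)%:E)%E)
    (fun s => (\int[K s]_y (g y)%:E)%E) (cst B%:E).
- by move=> n; apply: measurable_funS (mK _ _) => //; exact/measurable_EFinP.
- by apply: measurable_funS (mK _ _) => //; exact/measurable_EFinP.
- apply: aeW => s /=; rewrite in_itv/= => st.
  by have [] := dct g_ g s st mg_ mg (g_h s st) (g_g s st).
- exact: iB.
- apply: aeW => s n /=; rewrite in_itv/= => st; apply: bB => //.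
  by apply: filterS (g_h s st) => y.
have ig s : 0 <= s <= t -> (K s).-integrable setT (EFin \o g).
  by move=> st; have [] := dct g_ g s st mg_ mg (g_h s st) (g_g s st).
have : (\int[K t]_y (f y)%:E = c%:E +
    \int[lebesgue_measure]_(s in `[0%R, t]) \int[K s]_y (g y)%:E)%E.
  apply: cvg_unique cf _ => //.
  rewrite /= (funext E).
  apply: cvgeD => //; last by apply: cvg_EFin c_c; apply: nearW.
rewrite {1}/Rintegral => ->.
rewrite fineD//; last exact: integrable_fin_num iI.
congr (_ + _); rewrite [RHS]/Rintegral; congr fine.
apply: eq_integral => s; rewrite inE/= in_itv/= => st.
by rewrite fineK//; exact: integrable_fin_num (ig s st).
Qed.

(** * Exponential moments of the walk *)

Section walk_exponential_moment.
Context (R : realType) (k : R) (W : R.-pker (measurableTypeR R * int) ~> int).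
Hypothesis k0 : 0 <= k.
Hypothesis walkW : symmetric_walk k W.
Variable lam : R.
Hypothesis lam1 : 1 <= lam.

Let lam0 : 0 < lam. Proof. exact: lt_le_trans lam1. Qed.

Let lam_neq0 : lam != 0. Proof. by rewrite gt_eqF. Qed.

(** The eigenvalue of the walk generator for the eigenfunction [lam ^ n], that is, the logarithmic
    moment generating function of the walk per unit time at [ln lam]. *)
Definition walk_exponent := 2 * k * (lam + lam^-1 - 2).

Lemma walk_exponent_ge0 : 0 <= walk_exponent.
Proof.
rewrite /walk_exponent !mulr_ge0//.
rewrite (_ : _ - 2 = (lam - 1) ^+ 2 / lam); last by field.
by rewrite divr_ge0 ?sqr_ge0// ltW.
Qed.

(** The cap makes the exponential bounded, so that the generator identity of the walk applies to
    it. *)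
Let trunc (N : nat) (n : int) : R := lam ^ (Num.min n N%:Z).

Let expS (n : int) : lam ^ (n + 1) = lam * lam ^ n.
Proof. by rewrite expfzDr// expr1z mulrC. Qed.

Let expP (n : int) : lam ^ (n - 1) = lam^-1 * lam ^ n.
Proof. by rewrite expfzDr// exprN1 mulrC. Qed.

Let trunc_ge0 N n : 0 <= trunc N n. Proof. by rewrite exprz_ge0// ltW. Qed.

Let trunc_le N n : trunc N n <= lam ^ n.
Proof. by apply: ler_weXz2l => //; rewrite ge_min lexx. Qed.

Let trunc_bound N n : trunc N n <= lam ^ N.
Proof. by apply: ler_weXz2l => //; rewrite ge_min lexx orbT. Qed.

(* The capped exponential is a supersolution: below the cap it is dominated by
   the eigenfunction [lam ^ n], above it the Laplacian is nonpositive. *)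
Let trunc_generator N n :
  walk_generator k (trunc N) n <= walk_exponent * trunc N n.
Proof.
have [nN|Nn] := ltP n N%:Z.
  have e : trunc N n = lam ^ n by rewrite /trunc min_l// ltW.
  have := trunc_le N (n + 1); have := trunc_le N (n - 1).
  rewrite /walk_generator /walk_exponent expS expP e => a b.
  have -> : 2 * k * (lam + lam^-1 - 2) * lam ^ n =
    2 * k * (lam * lam ^ n - lam ^ n) + 2 * k * (lam^-1 * lam ^ n - lam ^ n) by ring.
  by apply: lerD; apply: ler_wpM2l; rewrite ?mulr_ge0// lerB.
have e : trunc N n = lam ^ N by rewrite /trunc min_r.
apply: (@le_trans _ _ 0); last by rewrite mulr_ge0// walk_exponent_ge0.
rewrite /walk_generator e -oppr_ge0 opprD.
by apply: addr_ge0; rewrite oppr_ge0 mulr_ge0_le0 ?mulr_ge0// subr_le0 trunc_bound.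
Qed.

Let trunc_cvg n : trunc ^~ n @ \oo --> lam ^ n.
Proof.
apply: cvg_near_cst.
near=> N; rewrite /trunc min_l//.
have : (`|n| <= N)%N by near: N; exact: nbhs_infty_ge.
lia.
Unshelve. all: by end_near. Qed.

Let trunc_norm N n : `|trunc N n| <= lam ^ N.
Proof. by rewrite ger0_norm. Qed.

(** Gronwall's inequality by iteration: [trunc_generator] and [trunc N 0 = 1] bound the mean [w] by
    1 plus [walk_exponent] times its time integral. The Taylor sums converge to the exponential and
    the remainder, of order [lam ^ N], vanishes for fixed [N]. *)
Let trunc_mean_le N (t : R) : 0 <= t ->
  \int[W (t, 0%R)]_n trunc N n <= expR (walk_exponent * t).
Proof.
move=> t0; have W1 s : (W s setT = 1)%E by exact: prob_kernel.
pose w (s : R) := \int[W (s, 0%R)]_n trunc N n.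
have mw : measurable_fun setT w by exact: measurable_kernel_mean.
have wb (s : R) : `|w s| <= lam ^ N.
  by apply: normr_Rintegral_le => //; exact: aeW.
have iw (a s : R) : (@lebesgue_measure R).-integrable `[0, s]
    (EFin \o (fun r => a * w r)).
  apply: (@bounded_integrable_itv _ _ (`|a| * lam ^ N)).
    by apply: measurable_funM.
  by move=> r r0; rewrite normrM ler_wpM2l.
pose z n s := walk_exponent ^+ n * w s.
have := @taylor_upper R z (fun n => walk_exponent ^+ n)
  (fun n => lam ^ N * walk_exponent ^+ n).
move=> /(_ _ _ _ _ t t0) H.
have := cvgD (@cvg_series_scaled_exp R walk_exponent t)
  (@cvg_scaled_exp_coeff R (lam ^ N) walk_exponent t).
rewrite addr0 => /(_ _) C; apply: (ler_cvg_to (cvg_cst (w t)) C).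
apply: nearW => n /=.
rewrite (_ : w t = z 0%N t); last by rewrite /z expr0 mul1r.
apply: H.
- by move=> m s s0; exact: iw.
- move=> m s s0; rewrite /z /w (@walk_mean _ k W k0 walkW _ (lam ^ N))//.
  have -> : trunc N 0 = 1 by rewrite /trunc min_l.
  rewrite mulrDr mulr1 lerD2l -RintegralZl//; last first.
    apply: (@bounded_integrable_itv _ _ (8 * k * lam ^ N)).
      exact: measurable_kernel_mean.
    move=> r r0; apply: normr_Rintegral_le => //.
    by apply: aeW => y; exact: walk_generator_bound.
  apply: le_Rintegral => //.
  + rewrite (_ : _ \o _ = fun r : R => ((walk_exponent ^+ m)%:E *
      (\int[W (r, 0%R)]_n walk_generator k (trunc N) n)%:E)%E)//.
    apply: integrableZl => //.
    apply: (@bounded_integrable_itv _ _ (8 * k * lam ^ N)).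
      exact: measurable_kernel_mean.
    move=> r r0; apply: normr_Rintegral_le => //.
    by apply: aeW => y; exact: walk_generator_bound.
  + move=> r _; rewrite exprSr -mulrA ler_wpM2l ?exprn_ge0 ?walk_exponent_ge0//.
    rewrite -RintegralZl//; last first.
      by apply: integrable_ae_bounded => //; apply: aeW; exact: trunc_norm.
    apply: le_Rintegral => //.
    * apply: (@integrable_ae_bounded _ _ _ _ _ _ (8 * k * lam ^ N)) => //.
      by apply: aeW => y; exact: walk_generator_bound.
    * rewrite (_ : _ \o _ = fun n => (walk_exponent%:E * (trunc N n)%:E)%E)//.
      apply: integrableZl => //.
      by apply: integrable_ae_bounded => //; apply: aeW; exact: trunc_norm.
- move=> m s s0; rewrite /z mulrC ler_wpM2r ?exprn_ge0 ?walk_exponent_ge0//.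
  by rewrite (le_trans (ler_norm _)).
Qed.

(** The bound for the capped exponentials does not depend on the cap, which is removed by monotone
    convergence. *)
Lemma walk_exp_moment_le (t : R) : 0 <= t ->
  (\int[W (t, 0%R)]_n (lam ^ n)%:E <= (expR (walk_exponent * t))%:E)%E.
Proof.
move=> t0; have W1 s : (W s setT = 1)%E by exact: prob_kernel.
have := @cvg_monotone_convergence _ _ _ (W (t, 0%R)) setT measurableT
  (fun N n => (trunc N n)%:E) => /(_ _ _ _) H.
have {}H := H (fun=> discrete_measurable_fun _) (fun N n _ => trunc_ge0 N n).
have homo n : [set: int] n ->
    {homo (fun N => (trunc N n)%:E) : N M / (N <= M)%N >-> (N <= M)%E}.
  move=> _ N M NM; rewrite lee_fin; apply: ler_weXz2l => //.
  by rewrite le_min ge_min lexx/= ge_min lez_nat NM orbT.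
have {}H := H homo.
rewrite (_ : (fun n => (lam ^ n)%:E) = fun n => limn (fun N => (trunc N n)%:E)).
  apply: cvge_le H; apply: nearW => N /=.
  rewrite -(@fineK _ (\int[_]_x _)%E); first by rewrite lee_fin trunc_mean_le.
  apply: integrable_fin_num => //.
  by apply: integrable_ae_bounded => //; apply: aeW; exact: trunc_norm.
apply/funext => n; apply/esym/cvg_lim => //.
by apply: cvg_EFin; [exact: nearW|exact: trunc_cvg].
Qed.

Let exp_generator n :
  walk_generator k (fun n => lam ^ n) n = walk_exponent * lam ^ n.
Proof. by rewrite /walk_generator /walk_exponent expS expP; ring. Qed.

(** The upper bound makes [lam ^ n] integrable, so the generator identity passes to the limit in the
    cap by dominated convergence and becomes an exact linear integral equation for the moment.
    Iterating that equation gives the lower bound. *)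
Lemma walk_exp_momentE (t : R) : 0 <= t ->
  \int[W (t, 0%R)]_n (lam ^ n) = expR (walk_exponent * t).
Proof.
move=> t0; have W1 s : (W s setT = 1)%E by exact: prob_kernel.
pose m (s : R) := \int[W (s, 0%R)]_n (lam ^ n).
have iexp (s : R) : 0 <= s ->
    (W (s, 0%R)).-integrable setT (EFin \o (fun n : int => lam ^ n)).
  move=> s0; apply/integrableP; split; first exact: discrete_measurable_fun.
  under eq_integral do rewrite /= ger0_norm ?exprz_ge0 ?(ltW lam0)//.
  by apply: le_lt_trans (walk_exp_moment_le s0) _; rewrite ltry.
have m_le (s : R) : 0 <= s -> m s <= expR (walk_exponent * s).
  move=> s0; rewrite -lee_fin fineK; first exact: walk_exp_moment_le.
  exact: integrable_fin_num (iexp s s0).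
have m_ge0 (s : R) : 0 <= m s.
  by apply: Rintegral_ge0 => n _; rewrite exprz_ge0// ltW.
have mm : measurable_fun setT m by exact: measurable_kernel_mean.
have im (a s : R) : (@lebesgue_measure R).-integrable `[0, s]
    (EFin \o (fun r => a * m r)).
  rewrite (_ : _ \o _ = fun r => (a%:E * (m r)%:E)%E)//.
  apply: integrableZl => //.
  apply: (@le_integrable _ _ _ _ _ _ _ (cst (expR (walk_exponent * s))%:E)) => //.
  - by apply/measurable_EFinP; apply: measurable_funS mm.
  - move=> r /=; rewrite in_itv/= => /andP[r0 rs].
    rewrite lee_fin !ger0_norm ?expR_ge0// (le_trans (m_le r r0))// ler_expR.
    by rewrite ler_wpM2l// walk_exponent_ge0.
  - rewrite -[cst _]/(EFin \o cst _).
    apply: continuous_compact_integrable; first exact: segment_compact.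
    by apply: continuous_subspaceT => x; exact: cvg_cst.
have im1 (s : R) : (@lebesgue_measure R).-integrable `[0, s] (EFin \o m).
  have := im 1 s; rewrite (_ : (fun r => 1 * m r) = m)//.
  by apply/funext => r; rewrite mul1r.
have eqm (s : R) : 0 <= s ->
    m s = 1 + walk_exponent * \int[lebesgue_measure]_(r in `[0, s]) m r.
  move=> s0.
  (* The first summand dominates the generator of the capped exponentials relative to [lam ^ n]; the
     added 1 makes [C * lam ^ n] dominate the capped exponentials too and keeps [C] positive when
     [k = 0]. *)
  pose C := 2 * k * (lam + lam^-1 + 2) + 1.
  have C1 : 1 <= C.
    by rewrite /C lerDr !mulr_ge0// !addr_ge0// ?invr_ge0 ltW.
  have := @kernel_equation_limit _ int R (fun r => W (r, 0%R)) trunc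
    (fun N => walk_generator k (trunc N)) (fun n => lam ^ n)
    (walk_generator k (fun n => lam ^ n)) (fun n => C * lam ^ n) (fun=> 1) 1
    (C * expR (walk_exponent * s)) s.
  move=> /(_ _ (fun=> discrete_measurable_fun _) (fun=> discrete_measurable_fun _)
    (discrete_measurable_fun _) (discrete_measurable_fun _)
    (discrete_measurable_fun _)) H.
  rewrite {1}/m H//; last first.
  - move=> N; case: walkW => _ /(_ (trunc N)).
    have -> : (1%:E = (trunc N 0)%:E)%E by rewrite /trunc min_l.
    by apply => //; exists (lam ^ N).
  - exact: cvg_cst.
  - move=> r r0; apply: aeW => n; rewrite /walk_generator.
    by apply: cvgD; apply: cvgMr; apply: cvgB; exact: trunc_cvg.
  - move=> r r0; apply: aeW => n N; rewrite /C mulrDl mul1r.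
    rewrite -[leLHS]addr0 lerD ?exprz_ge0 ?(ltW lam0)//.
    rewrite ler_norml /walk_generator.
    have := trunc_le N (n + 1); have := trunc_le N (n - 1).
    have := trunc_le N n; rewrite expS expP.
    have := trunc_ge0 N (n + 1); have := trunc_ge0 N (n - 1).
    have := trunc_ge0 N n => a1 a2 a3 b1 b2 b3.
    have -> : 2 * k * (lam + lam^-1 + 2) * lam ^ n =
      2 * k * (lam * lam ^ n + lam ^ n) + 2 * k * (lam^-1 * lam ^ n + lam ^ n) by ring.
    have k2 : 0 <= 2 * k by rewrite mulr_ge0.
    by apply/andP; split; nra.
  - by apply: aeW => n; exact: trunc_cvg.
  - apply: aeW => n N; rewrite ger0_norm// (le_trans (trunc_le _ _))//.
    by rewrite ler_peMl// exprz_ge0// ltW.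
  - move=> r /andP[r0 rs].
    under eq_integral do rewrite EFinM.
    rewrite ge0_integralZl//; last 2 first.
    + by move=> n _; rewrite lee_fin exprz_ge0// ltW.
    + by rewrite lee_fin (le_trans _ C1).
    rewrite EFinM lee_pmul2l// ?lte_fin ?(lt_le_trans _ C1)//.
    apply: le_trans (walk_exp_moment_le r0) _.
    by rewrite lee_fin ler_expR ler_wpM2l// walk_exponent_ge0.
  - by move=> n; rewrite mulr_ge0 ?exprz_ge0 ?(ltW lam0)// (le_trans _ C1).
  - by move=> f; exact: measurable_kernel_time.
  congr (_ + _); rewrite -RintegralZl//.
  apply: eq_Rintegral => r; rewrite inE/= in_itv/= => /andP[r0 _].
  rewrite /m -RintegralZl//; last exact: iexp.
  by apply: eq_Rintegral => n _; rewrite exp_generator.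
apply/eqP; rewrite eq_le m_le//=.
(* With signs reversed the remainder is nonpositive, so 0 bounds it and every partial sum of the
   exponential series lies below [m t]. *)
have := @taylor_upper R (fun n s => - walk_exponent ^+ n * m s)
  (fun n => - walk_exponent ^+ n) (fun=> 0) => /(_ _ _ _ _ t t0) H.
rewrite -lerN2; have /(_ _) C := cvgN (@cvg_series_scaled_exp R walk_exponent t).
apply: (ler_cvg_to (cvg_cst (- m t)) C); apply: nearW => n /=.
have {}H := H _ _ _ n; move: H; rewrite expr0 mulN1r mul0r addr0.
move=> H; apply: le_trans (H _ _ _) _.
- by move=> p s s0; exact: im.
- move=> p s s0; rewrite [X in _ * X]eqm// mulrDr mulr1 lerD2l.
  by rewrite mulrA mulNr -exprSr RintegralZl.
- by move=> p s s0; rewrite mulNr oppr_le0 mulr_ge0 ?exprn_ge0 ?walk_exponent_ge0.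
- by rewrite opprfctE -sumrN; apply: ler_sum => p _; rewrite mulNr.
Qed.

End walk_exponential_moment.

(** * Energies of configurations *)

Section energy.
Context {R : realType}.
Implicit Types (x y : config R) (i : int).

Lemma measurable_coordinate i : measurable_fun setT (fun x : config R => x i).
Proof. by move=> _ B mB; rewrite setTI; apply: sub_sigma_algebra; exists i, B. Qed.

Definition segment_energy i (n : nat) x : R := \sum_(j < n) x (i + j%:Z).

Lemma segment_energyS i n x :
  segment_energy i n.+1 x = segment_energy i n x + x (i + n%:Z).
Proof. by rewrite /segment_energy big_ord_recr. Qed.

Lemma segment_energy_recl i n x :
  segment_energy i n.+1 x = x i + segment_energy (i + 1) n x.
Proof.
rewrite /segment_energy big_ord_recl addr0; congr (_ + _).
by apply: eq_bigr => j _; rewrite -addrA.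
Qed.

Lemma measurable_segment_energy i n : measurable_fun setT (segment_energy i n).
Proof.
elim: n => [|n IH].
  rewrite (_ : segment_energy i 0 = cst 0); first exact: measurable_cst.
  by apply/funext => x; rewrite /segment_energy big_ord0.
rewrite (_ : segment_energy i n.+1 =
  fun x : config R => segment_energy i n x + x (i + n%:Z)).
  by apply: measurable_funD => //; exact: measurable_coordinate.
by apply/funext => x; rewrite segment_energyS.
Qed.

Lemma segment_energy_ge0 i n x : nonneg_config x -> 0 <= segment_energy i n x.
Proof. by move=> x0; apply: sumr_ge0 => j _; exact: x0. Qed.

(* [esum] is a supremum over finite subsets, so negative terms are dropped. *)
Lemma esum_posE (S : set int) (a : int -> R) :
  (\esum_(l in S) (a l)%:E = \esum_(l in S) (Num.max (a l) 0)%:E)%E.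
Proof.
apply/eqP; rewrite eq_le; apply/andP; split.
  by apply: le_esum => l _; rewrite lee_fin le_max lexx.
apply: ge_ereal_sup => _ [A [fA AS] <-].
apply: esum_ge; exists (A `&` [set l | 0 < a l]).
  by split; [exact: finite_setIl|move=> l [/AS]].
rewrite fsbig_mkcondr le_eqVlt; apply/orP; left; apply/eqP.
apply: eq_fsbigr => l _; rewrite maxC/Num.max.
case: ifPn => [al|]; first by rewrite mem_set.
by rewrite -leNgt => al; rewrite memNset//= => /(le_lt_trans al); rewrite ltxx.
Qed.

(** A series of measurable functions of single coordinates, valid also for configurations with
    negative entries; it makes [energy_from] measurable on the whole configuration space. *)
Lemma energy_tailE i y :
  (\esum_(l in [set l : int | (i <= l)%R]) (y l)%:E =
   \sum_(0 <= n <oo) (Num.max (y (i + n%:Z)) 0)%:E)%E.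
Proof.
rewrite esum_posE nneseries_esumT => [|n]; last by rewrite lee_fin le_max lexx orbT.
rewrite (@reindex_esum _ _ _ setT _ (fun n : nat => i + n%:Z))//.
split.
- by move=> n _ /=; rewrite lerDl.
- by move=> m n _ _ /addrI [].
- move=> l /= il; exists `|l - i|%N => //.
  lia.
Qed.

Lemma measurable_energy_from i : measurable_fun setT (@energy_from R i).
Proof.
apply: measurableT_comp => //.
rewrite (_ : (fun x => _) = fun x : config R =>
    (\sum_(0 <= n <oo) (Num.max (x (i + n%:Z)) 0)%:E)%E); last first.
  by apply/funext => x; rewrite energy_tailE.
apply: (@ge0_emeasurable_sum _ _ _ _
  (fun n y => (Num.max (y (i + n%:Z)) 0)%:E) xpredT).
- by move=> n y _ _; rewrite lee_fin le_max lexx orbT.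
- move=> n _; apply/measurable_EFinP; apply: measurable_maxr => //.
  exact: measurable_coordinate.
Qed.

Lemma finite_energy_coordinate y (E : R) i :
  nonneg_config y -> total_energy y = E%:E -> 0 <= y i <= E.
Proof.
move=> y0 yE; rewrite y0 -lee_fin -yE; apply: esum_ge.
by exists [set i]; [split => //; exact: finite_set1|rewrite fsbig_set1].
Qed.

Lemma energy_tail_le i y : nonneg_config y ->
  (\esum_(l in [set l : int | (i <= l)%R]) (y l)%:E <= total_energy y)%E.
Proof.
move=> y0; rewrite /total_energy [leRHS](esumID [set l : int | (i <= l)%R])//;
  last by move=> l _; rewrite lee_fin y0.
by rewrite setTI leeDl// esum_ge0// => l _; rewrite lee_fin y0.
Qed.

Lemma segment_energy_cvg i y : finite_energy y ->
  segment_energy i ^~ y @ \oo --> energy_from i y.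
Proof.
move=> [y0 fy].
have tail_fin : (\esum_(l in [set l : int | (i <= l)%R]) (y l)%:E)%E \is a fin_num.
  rewrite ge0_fin_numE; first exact: le_lt_trans (energy_tail_le i y0) fy.
  by apply: esum_ge0 => l _; rewrite lee_fin y0.
suff : ((segment_energy i n y)%:E @[n --> \oo] --> (energy_from i y)%:E)%E.
  by move=> /fine_cvgP[].
rewrite /energy_from fineK// energy_tailE.
rewrite (_ : (fun n => _) = fun n => (\sum_(0 <= j < n) (Num.max (y (i + j%:Z)) 0)%:E)%E).
  apply: is_cvg_nneseries => n _ _; by rewrite lee_fin le_max lexx orbT.
apply/funext => n; rewrite /= sumEFin big_mkord; congr EFin.
by apply: eq_bigr => j _; rewrite max_l// y0.
Qed.

(** These are the terms of a convergent series. Their decay removes the boundary contribution at the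
    far end of a growing segment. *)
Lemma coordinate_cvg0 i y : finite_energy y ->
  (fun n : nat => y (i + n%:Z)) @ \oo --> (0 : R).
Proof.
move=> fy; rewrite -(subrr (energy_from i y)).
rewrite (_ : (fun n => _) = fun n => segment_energy i n.+1 y - segment_energy i n y).
  apply: cvgB; last exact: segment_energy_cvg.
  by have := @segment_energy_cvg i _ fy; rewrite -cvg_shiftS.
by apply/funext => n; rewrite segment_energyS addrAC subrr add0r.
Qed.

Lemma energy_from_recl i y : finite_energy y ->
  energy_from i y = y i + energy_from (i + 1) y.
Proof.
move=> fy; have := @segment_energy_cvg i _ fy; rewrite -cvg_shiftS => H.
apply: cvg_unique H _ => //.
rewrite (_ : (fun n => _) = fun n => y i + segment_energy (i + 1) n y).
  by apply: cvgD; [exact: cvg_cst|exact: segment_energy_cvg].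
by apply/funext => n; rewrite -segment_energy_recl.
Qed.

Lemma energy_from_ge0 i y : nonneg_config y -> 0 <= energy_from i y.
Proof. by move=> y0; apply: fine_ge0; apply: esum_ge0 => l _; rewrite lee_fin y0. Qed.

End energy.

(** * The ABEP generator on exponentials of energies *)

Lemma continuous_expR_sum (R : realType) (T : topologicalType) (I : finType)
    (c a : R) (f : I -> T -> R) : (forall j, continuous (f j)) ->
  continuous (fun p => c * expR (a * \sum_j f j p)).
Proof.
move=> cf p.
have cs (s : seq I) : \sum_(j <- s) f j q @[q --> p] --> \sum_(j <- s) f j p.
  elim: s => [|j s IH].
    by rewrite big_nil; under eq_fun do rewrite big_nil; exact: cvg_cst.
  rewrite big_cons; under eq_fun do rewrite big_cons.
  by apply: cvgD => //; exact: cf.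
apply: cvgM; first exact: cvg_cst.
apply: continuous_cvg; first exact: continuous_expR.
by apply: cvgM; [exact: cvg_cst|exact: cs].
Qed.

Lemma is_derive_expZ (R : realType) (c b : R) :
  is_derive (0 : R) 1 (fun h => c * expR (h * b)) (c * b).
Proof.
have H : is_derive (0 : R) 1 (fun h => c * expR (h * b))
    (c * (expR (0 * b) * b)).
  rewrite (_ : (fun h => _) = c \*: (expR \o (fun h : R => h * b))); last by [].
  have Hb : is_derive (0 : R) 1 (fun h : R => h * b) b.
    rewrite (_ : (fun h => _) = b \*: (@id R)).
      by apply: is_derive_eq; rewrite scaler1.
    by apply/funext => h; rewrite mulrC.
  exact: (is_deriveZ _ (is_derive1_comp (is_derive_expR _) Hb)).
by apply: is_derive_eq H _; rewrite mul0r expR0 mul1r.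
Qed.

Section exponential_of_linear.
Context {R : realType} (n : nat) (a : R).

Let L (v : 'rV[R]_n.+1) : R := a * \sum_j v ord0 j.

Let expL_line (c : R) (p v : 'rV[R]_n.+1) :
  (fun h : R => c * expR (L (h *: v + p))) =
  (fun h : R => c * expR (L p) * expR (h * L v)).
Proof.
apply/funext => h; rewrite -mulrA -expRD; congr (_ * expR _).
rewrite /L mulrCA -mulrDr addrC; congr (_ * _).
rewrite mulr_sumr -big_split/=; apply: eq_bigr => j _.
by rewrite !mxE addrC.
Qed.

Let derive_expL (c : R) (p v : 'rV[R]_n.+1) :
  derivable (fun p => c * expR (L p)) p v /\
  'D_v (fun p => c * expR (L p)) p = c * L v * expR (L p).
Proof.
have [dl el] := is_derive_expZ (c * expR (L p)) (L v).
have E : (fun h : R => h^-1 *: (((fun p => c * expR (L p)) \o shift p) (h *: v) -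
   c * expR (L p))) = (fun h : R => h^-1 *: (((fun h => c * expR (L p) *
   expR (h * L v)) \o shift 0) (h *: 1) - c * expR (L p) * expR (0 * L v))).
  apply/funext => h /=; rewrite mul0r expR0 mulr1 addr0 scaler1.
  by rewrite (congr1 (fun f => f h) (expL_line c p v)).
split; first by rewrite /derivable E.
by rewrite /derive E -[RHS]mulrAC -el.
Qed.

Let derivable_expL c p v : derivable (fun p => c * expR (L p)) p v.
Proof. by have [] := derive_expL c p v. Qed.

Let derive_expLE c v :
  'D_v (fun p => c * expR (L p)) = (fun p => c * L v * expR (L p)).
Proof. by apply/funext => p; have [] := derive_expL c p v. Qed.

Let expL_continuous c : continuous (fun p => c * expR (L p)).
Proof.
by apply: continuous_expR_sum => j; exact: coord_continuous.
Qed.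

Let expL_C1 c : is_C1 (fun p => c * expR (L p)).
Proof.
move=> v; split; first by move=> p; exact: derivable_expL.
by rewrite derive_expLE; exact: expL_continuous.
Qed.

(** A directional derivative sends [c * expR (L p)] to a function of the same form with another
    constant, so first-order regularity for all [c] already gives second-order regularity. *)
Lemma is_C2_exp_linear : is_C2 (fun v : 'rV[R]_n.+1 => expR (a * \sum_j v ord0 j)).
Proof.
have E : (fun v : 'rV[R]_n.+1 => expR (a * \sum_j v ord0 j)) =
    (fun p => 1 * expR (L p)) by apply/funext => v; rewrite mul1r.
by rewrite E; split => // v; rewrite derive_expLE.
Qed.

End exponential_of_linear.

Section segment_exponential.
Context {R : realType} (sigma k : R).
Hypothesis sigma0 : 0 < sigma.
Implicit Types (x y : config R) (i j : int).

Definition segment_exp i n x := expR (- (2 * sigma * segment_energy i n x)).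

(** Real-valued because it is the derivative of [segment_energy i n] in the coordinate [j]. *)
Definition in_segment i (n : nat) j : R := ((i <= j) && (j < i + n%:Z))%:R.

Lemma segment_exp_cylinder i n : C2_cylinder (segment_exp i n.+1).
Proof.
exists n, i, (fun v : 'rV[R]_n.+1 => expR (- (2 * sigma) * \sum_j v ord0 j)).
split; first exact: is_C2_exp_linear.
move=> x; rewrite /segment_exp mulNr; congr (expR (- (_ * _))).
by apply: eq_bigr => j _; rewrite mxE.
Qed.

Lemma segment_energy_shift i n j h x :
  segment_energy i n (shift_coord j h x) =
  segment_energy i n x + h * in_segment i n j.
Proof.
elim: n => [|n IH].
  rewrite /segment_energy !big_ord0 /in_segment addr0.
  by rewrite leNgt; case: (j < i); rewrite /= mulr0 addr0.
rewrite !segment_energyS IH /shift_coord /in_segment.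
case: eqP => [<-|/eqP ne].
  have -> : (i <= i + n%:Z) && (i + n%:Z < i + n%:Z) = false by lia.
  have -> : (i <= i + n%:Z) && (i + n%:Z < i + n.+1%:Z) by lia.
  by rewrite mulr0 mulr1 addr0 addrA.
have -> : (i <= j) && (j < i + n.+1%:Z) = (i <= j) && (j < i + n%:Z).
  by apply/idP/idP; move: ne; lia.
by rewrite addrAC.
Qed.

(** The constant [c] lets the rule be applied to its own result, as the second bond derivative
    requires. *)
Lemma partial_segment_exp c i n j :
  partial j (fun x => c * segment_exp i n x) =
  (fun x => - (2 * sigma) * in_segment i n j * c * segment_exp i n x).
Proof.
apply/funext => x; rewrite /partial.
set D := in_segment i n j.
have -> : (fun h => c * segment_exp i n (shift_coord j h x)) =
    (fun h : R => c * segment_exp i n x * expR (h * (- (2 * sigma) * D))).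
  apply/funext => h; rewrite /segment_exp segment_energy_shift -/D.
  by rewrite -[RHS]mulrA -expRD; congr (_ * expR _); ring.
have [_] := is_derive_expZ (c * segment_exp i n x) (- (2 * sigma) * D).
rewrite derive1E => ->; ring.
Qed.

Lemma bond_derivative_segment_exp c i n j :
  bond_derivative j (fun x => c * segment_exp i n x) =
  (fun x => - (2 * sigma) * (in_segment i n j - in_segment i n (j + 1)) * c *
     segment_exp i n x).
Proof.
by rewrite /bond_derivative !partial_segment_exp; apply/funext => x; ring.
Qed.

(** The derivatives produce powers of [2 * sigma] that cancel the prefactors. [D] vanishes unless
    the bond crosses an end of the segment. It is -1 at the left end, where the two products [a * b]
    cancel and only the linear part survives, and 1 at the right end, where they add up. *)
Lemma bond_generator_segment_exp i n j x :
  bond_generator sigma k j (segment_exp i n) x =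
  let D := in_segment i n j - in_segment i n (j + 1) in
  let a := 1 - expR (- (2 * sigma * x j)) in
  let b := expR (2 * sigma * x (j + 1)) - 1 in
  (a * b * D ^+ 2 + (a * b + 2 * k * (2 - expR (- (2 * sigma * x j))
    - expR (2 * sigma * x (j + 1)))) * D) * segment_exp i n x.
Proof.
have E : segment_exp i n = (fun x => 1 * segment_exp i n x).
  by apply/funext => y; rewrite mul1r.
rewrite /bond_generator {1 2}E !bond_derivative_segment_exp /= mulr1.
set D := in_segment i n j - _; set F := segment_exp _ _ _.
by clear E; field; rewrite gt_eqF.
Qed.

Lemma segment_exp_recl i n x :
  segment_exp i n.+1 x = expR (- (2 * sigma * x i)) * segment_exp (i + 1) n x.
Proof. by rewrite /segment_exp segment_energy_recl mulrDr opprD expRD. Qed.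

(** Only the bonds at [i - 1] and [i + n] contribute. At the left one the factors
    [expR (- (2 * sigma * x (i - 1)))] and [expR (2 * sigma * x i)] extend or shorten the segment by
    one site, which is a jump of the walk; the last summand is the boundary term at the right. All
    segments on the right-hand side end at the same site [i + n]. *)
Lemma abep_generator_segment_exp i n x :
  abep_generator sigma k (segment_exp i n.+1) x =
  2 * k * (segment_exp (i - 1) n.+2 x - segment_exp i n.+1 x) +
  2 * k * (segment_exp (i + 1) n x - segment_exp i n.+1 x) +
  (let ea := expR (- (2 * sigma * x (i + n%:Z))) in
   let eb := expR (2 * sigma * x (i + n.+1%:Z)) in
   2 * ((1 - ea) * (eb - 1)) + 2 * k * (2 - ea - eb)) * segment_exp i n.+1 x.
Proof.
rewrite /abep_generator (@fsbigE _ _ _ _ _ [:: i - 1; i + n%:Z])//; last first.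
- move=> j _; rewrite !inE negb_or => /andP[j1 j2].
  rewrite bond_generator_segment_exp/=.
  have -> : in_segment i n.+1 j = in_segment i n.+1 (j + 1).
    by rewrite /in_segment; congr (_%:R); congr nat_of_bool;
      apply/idP/idP; move: j1 j2; lia.
  by rewrite subrr expr0n/= !mulr0 addr0 mul0r.
- by rewrite /= inE andbT; lia.
rewrite !big_cons big_nil !mem_setT [LHS]/= [X in _ + X]addr0.
rewrite !bond_generator_segment_exp/=.
have -> : in_segment i n.+1 (i - 1) = 0.
  by rewrite /in_segment (_ : _ && _ = false)//; lia.
have -> : in_segment i n.+1 (i - 1 + 1) = 1.
  by rewrite /in_segment (_ : _ && _ = true)//; lia.
have -> : in_segment i n.+1 (i + n%:Z) = 1.
  by rewrite /in_segment (_ : _ && _ = true)//; lia.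
have -> : in_segment i n.+1 (i + n%:Z + 1) = 0.
  by rewrite /in_segment (_ : _ && _ = false)//; lia.
rewrite subrK (_ : i + n%:Z + 1 = i + n.+1%:Z); last by lia.
rewrite (segment_exp_recl (i - 1)) subrK.
have -> : segment_exp (i + 1) n x = expR (2 * sigma * x i) * segment_exp i n.+1 x.
  by rewrite segment_exp_recl mulrA -expRD subrr expR0 mul1r.
by ring.
Qed.

End segment_exponential.

(** * Duality with the walk *)

Section abep_duality.
Context {R : realType} (sigma k : R)
  (P : R.-pker (measurableTypeR R * config R) ~> config R).
Hypothesis sigma0 : 0 < sigma.
Hypothesis k0 : 0 <= k.
Hypothesis abepP : is_abep sigma k P.
Implicit Types (x y : config R) (i : int).

Definition tail_exp i x := expR (- (2 * sigma * energy_from i x)).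

Lemma tail_exp_norm i y : nonneg_config y -> `|tail_exp i y| <= 1.
Proof.
move=> y0; rewrite ger0_norm ?expR_ge0// -[leRHS]expR0 ler_expR oppr_le0.
by rewrite !mulr_ge0 ?energy_from_ge0// ltW.
Qed.

Lemma segment_exp_itv i n y : nonneg_config y -> 0 <= segment_exp sigma i n y <= 1.
Proof.
move=> y0; rewrite expR_ge0/= -[leRHS]expR0 ler_expR oppr_le0.
by rewrite !mulr_ge0 ?segment_energy_ge0// ltW.
Qed.

Lemma measurable_tail_exp i : measurable_fun setT (tail_exp i).
Proof.
apply: measurableT_comp => //; apply: measurable_funN.
by apply: measurable_funM => //; exact: measurable_energy_from.
Qed.

Lemma measurable_segment_exp i n : measurable_fun setT (segment_exp sigma i n).
Proof.
apply: measurableT_comp => //; apply: measurable_funN.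
by apply: measurable_funM => //; exact: measurable_segment_energy.
Qed.

Lemma segment_exp_cvg i y : finite_energy y ->
  segment_exp sigma i ^~ y @ \oo --> tail_exp i y.
Proof.
move=> fy; apply: continuous_cvg; first exact: continuous_expR.
by apply: cvgN; apply: cvgMr; exact: segment_energy_cvg.
Qed.

Lemma expR_coordinate_cvg (a : R) i y : finite_energy y ->
  (fun n : nat => expR (a * y (i + n%:Z))) @ \oo --> (1 : R).
Proof.
move=> fy; rewrite -expR0 -(mulr0 a).
apply: continuous_cvg; first exact: continuous_expR.
by apply: cvgMr; exact: coordinate_cvg0.
Qed.

Lemma abep_generator_cvg i y : finite_energy y ->
  abep_generator sigma k (segment_exp sigma i n.+1) y @[n --> \oo] -->
  walk_generator k (tail_exp ^~ y) i.
Proof.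
move=> fy; have cS j m : segment_exp sigma j (n + m)%N y @[n --> \oo] --> tail_exp j y.
  by have := @segment_exp_cvg j _ fy; rewrite -(cvg_shiftn m).
(* The limit is written in the shape of the truncated formula, with the boundary exponentials
   replaced by their limit 1. *)
have -> : walk_generator k (tail_exp ^~ y) i =
    2 * k * (tail_exp (i - 1) y - tail_exp i y) +
    2 * k * (tail_exp (i + 1) y - tail_exp i y) +
    (2 * ((1 - 1) * (1 - 1)) + 2 * k * (2 - 1 - 1)) * tail_exp i y.
  by rewrite /walk_generator; ring.
rewrite (funext (fun n => abep_generator_segment_exp k sigma0 i n y))/=.
have e1 := @expR_coordinate_cvg (- (2 * sigma)) i y fy.
have e2 : expR (2 * sigma * y (i + n.+1%:Z)) @[n --> \oo] --> (1 : R).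
  by have := @expR_coordinate_cvg (2 * sigma) i y fy; rewrite -cvg_shiftS.
have {}e1 : expR (- (2 * sigma * y (i + n%:Z))) @[n --> \oo] --> (1 : R).
  by move: e1; under eq_fun do rewrite mulNr.
have s0 : segment_exp sigma (i + 1) n y @[n --> \oo] --> tail_exp (i + 1) y.
  exact: segment_exp_cvg.
have s1 : segment_exp sigma i n.+1 y @[n --> \oo] --> tail_exp i y.
  by have := cS i 1%N; under eq_fun do rewrite addn1.
have s2 : segment_exp sigma (i - 1) n.+2 y @[n --> \oo] --> tail_exp (i - 1) y.
  by have := cS (i - 1) 2%N; under eq_fun do rewrite addn2.
apply: cvgD.
  apply: cvgD; apply: cvgMr; [exact: cvgB s2 s1|exact: cvgB s0 s1].
apply: cvgM s1; apply: cvgD; apply: cvgMr.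
  by apply: cvgM; [apply: cvgB => //; exact: cvg_cst|apply: cvgB => //; exact: cvg_cst].
by apply: cvgB => //; apply: cvgB => //; exact: cvg_cst.
Qed.

(** Each coordinate is at most the total energy [E], so the boundary term is controlled by [E]
    alone. As the energy is conserved, the bound is uniform in time as well as in [n]. *)
Lemma abep_generator_bound (E : R) i n y :
  nonneg_config y -> total_energy y = E%:E ->
  `|abep_generator sigma k (segment_exp sigma i n.+1) y| <=
    2 * expR (2 * sigma * E) + 4 * k * (3 + expR (2 * sigma * E)).
Proof.
move=> y0 yE; rewrite (abep_generator_segment_exp k sigma0)/=.
have /andP[a0 aE] := finite_energy_coordinate (i + n%:Z) y0 yE.
have /andP[b0 bE] := finite_energy_coordinate (i + n.+1%:Z) y0 yE.
have /andP[s00 s01] := segment_exp_itv (i + 1) n y0.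
have /andP[s10 s11] := segment_exp_itv i n.+1 y0.
have /andP[s20 s21] := segment_exp_itv (i - 1) n.+2 y0.
have ea0 := expR_ge0 (- (2 * sigma * y (i + n%:Z))).
have ea1 : expR (- (2 * sigma * y (i + n%:Z))) <= 1.
  by rewrite -[leRHS]expR0 ler_expR oppr_le0 !mulr_ge0// ltW.
have eb1 : 1 <= expR (2 * sigma * y (i + n.+1%:Z)).
  by rewrite -[leLHS]expR0 ler_expR !mulr_ge0// ltW.
have ebM : expR (2 * sigma * y (i + n.+1%:Z)) <= expR (2 * sigma * E).
  by rewrite ler_expR ler_wpM2l// mulr_ge0// ltW.
move: (expR _) (expR (2 * sigma * y _)) (expR (2 * sigma * E)) ea0 ea1 eb1 ebM.
move: (segment_exp _ _ _ _) (segment_exp _ _ _ _) (segment_exp _ _ _ _)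
  s00 s01 s10 s11 s20 s21.
move=> s0 s1 s2 s00 s01 s10 s11 s20 s21 ea eb M ea0 ea1 eb1 ebM.
set A := 2 * k * _ + 2 * k * _; set B := 2 * _ + _.
have k2 (u v : R) : 0 <= u -> u <= 1 -> 0 <= v -> v <= 1 ->
    `|2 * k * (u - v)| <= 2 * k.
  move=> u0 u1 v0 v1; rewrite normrM ger0_norm ?mulr_ge0// ler_piMr ?mulr_ge0//.
  by rewrite ler_norml; apply/andP; split; lra.
have A1 : `|A| <= 2 * k + 2 * k by rewrite (le_trans (ler_normD _ _))// lerD ?k2.
have B1 : `|B| <= 2 * M + 2 * k * (2 + M).
  rewrite (le_trans (ler_normD _ _))// lerD//.
    by rewrite normrM ger0_norm// ler_wpM2l// ler_norml; apply/andP; split; nra.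
  rewrite normrM ger0_norm ?mulr_ge0// ler_wpM2l ?mulr_ge0//.
  by rewrite ler_norml; apply/andP; split; lra.
rewrite (le_trans (ler_normD _ _))//.
have : `|B * s1| <= 2 * M + 2 * k * (2 + M).
  by rewrite normrM (le_trans _ B1)// ler_piMr// ger0_norm.
have kM : 0 <= k * M by rewrite mulr_ge0//; lra.
move=> H; apply: le_trans (lerD A1 H) _.
rewrite -subr_ge0 [leRHS](_ : _ = 4 * k + 2 * (k * M)); last by ring.
by rewrite addr_ge0// mulr_ge0.
Qed.

(** The generator identity holds for the cylinder functions [segment_exp sigma i n.+1], and
    [kernel_equation_limit] carries it to the tail. The length is [n.+1] because a cylinder function
    is given through a nonempty row of coordinates. *)
Lemma abep_tail_heat x : finite_energy x ->
  heat_solution k (tail_exp ^~ x) (fun i t => \int[P (t, x)]_y tail_exp i y).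
Proof.
move=> fx; have P1 s : (P s setT = 1)%E by exact: prob_kernel.
have [[_ _ Pfin] Pcons Pgen] := abepP.
have x_fin : total_energy x \is a fin_num.
  rewrite ge0_fin_numE; first by case: fx.
  by apply: esum_ge0 => l _; rewrite lee_fin; case: fx => ->.
pose E := fine (total_energy x).
(* The constant of [abep_generator_bound]; being at least 2, it also dominates the segment
   exponentials, which are at most 1. *)
pose C := 2 * expR (2 * sigma * E) + 4 * k * (3 + expR (2 * sigma * E)).
have C2 : 2 <= C.
  have : 1 <= expR (2 * sigma * E).
    rewrite -[leLHS]expR0 ler_expR !mulr_ge0 ?(ltW sigma0)//.
    by apply: fine_ge0; apply: esum_ge0 => l _; rewrite lee_fin; case: fx => ->.
  by move=> e1; rewrite -[leLHS]addr0 lerD ?ler_peMr ?mulr_ge0 ?addr_ge0 ?expR_ge0.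
split.
- by move=> i; apply: measurable_kernel_mean; exact: measurable_tail_exp.
- exists 1 => i t t0; apply: normr_Rintegral_le => //; first exact: measurable_tail_exp.
  by apply: filterS (Pfin t x t0 fx) => y [y0 _]; exact: tail_exp_norm.
- move=> i t t0.
  have -> : \int[lebesgue_measure]_(s in `[0, t])
      walk_generator k ((fun i t => \int[P (t, x)]_y tail_exp i y) ^~ s) i =
      \int[lebesgue_measure]_(s in `[0, t]) \int[P (s, x)]_y
        walk_generator k (tail_exp ^~ y) i.
    apply: eq_Rintegral => s; rewrite inE/= in_itv/= => /andP[s0 _].
    rewrite (@Rintegral_walk_generator_ae _ _ _ _ _ k 1)//.
      by move=> j; exact: measurable_tail_exp.
    by move=> j; apply: filterS (Pfin s x s0 fx) => y [y0 _]; exact: tail_exp_norm.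
  apply: (@kernel_equation_limit _ (config R) R (fun r => P (r, x))
    (fun n => segment_exp sigma i n.+1)
    (fun n => abep_generator sigma k (segment_exp sigma i n.+1))
    (tail_exp i) (fun y => walk_generator k (tail_exp ^~ y) i) (cst C)
    (fun n => segment_exp sigma i n.+1 x) (tail_exp i x) C t) => //.
  + by move=> f; exact: measurable_kernel_time.
  + by move=> n; exact: measurable_segment_exp.
  + move=> n; rewrite (funext (abep_generator_segment_exp k sigma0 i n))/=.
    have mc (a : R) j : measurable_fun setT (fun y : config R => expR (a * y j)).
      apply: measurableT_comp => //; apply: measurable_funM => //.
      exact: measurable_coordinate.
    have mcN (a : R) j : measurable_fun setT (fun y : config R => expR (- (a * y j))).
      apply: measurableT_comp => //; apply: measurable_funN.
      by apply: measurable_funM => //; exact: measurable_coordinate.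
    have ms := measurable_segment_exp.
    apply: measurable_funD; last apply: measurable_funM => //.
      by apply: measurable_funD; apply: measurable_funM => //; apply: measurable_funB.
    by apply: measurable_funD; apply: measurable_funM => //;
      [apply: measurable_funM; apply: measurable_funB
      |apply: measurable_funB => //; apply: measurable_funB].
  + exact: measurable_tail_exp.
  + apply: (measurable_walk_generator k (u := tail_exp)) => j.
    exact: measurable_tail_exp.
  + by move=> y; rewrite (le_trans _ C2).
  + by move=> s st; rewrite [leLHS](@integral_cst _ _ _ (P (s, x)) _ _ C%:E)// P1 mule1.
  + apply: filterS (Pfin t x t0 fx) => y [y0 _] n.
    have /andP[s00 s01] := segment_exp_itv i n.+1 y0.
    by rewrite ger0_norm//= (le_trans s01)// (le_trans _ C2)// ler1n.
  + apply: filterS (Pfin t x t0 fx) => y fy.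
    by have := @segment_exp_cvg i _ fy; rewrite -cvg_shiftS.
  + move=> s /andP[s0 _]; near=> y => n.
    apply: abep_generator_bound.
      by near: y; apply: filterS (Pfin s x s0 fx) => y [].
    rewrite fineK//; near: y; exact: Pcons.
  + move=> s /andP[s0 _]; apply: filterS (Pfin s x s0 fx) => y fy.
    exact: abep_generator_cvg.
  + by have := @segment_exp_cvg i _ fx; rewrite -cvg_shiftS.
  + move=> n; apply: Pgen => //; exact: segment_exp_cylinder.
Unshelve. all: by end_near. Qed.

End abep_duality.

(** * The current as a functional of the walk *)

Section current_representation.
Context {R : realType} (sigma k : R)
  (P : R.-pker (measurableTypeR R * config R) ~> config R)
  (W : R.-pker (measurableTypeR R * int) ~> int).
Hypothesis sigma0 : 0 < sigma.
Hypothesis k0 : 0 <= k.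
Hypothesis abepP : is_abep sigma k P.
Hypothesis walkW : symmetric_walk k W.
Implicit Types (x y : config R) (i n : int).

(* [energy_from i x - energy_from (i + n) x] *)
Definition signed_energy i n x : R :=
  match n with
  | Posz m => segment_energy i m x
  | Negz m => - segment_energy (i - m.+1%:Z) m.+1 x
  end.

Lemma energy_from_segment i m x : finite_energy x ->
  energy_from i x = segment_energy i m x + energy_from (i + m%:Z) x.
Proof.
move=> fx; elim: m => [|m IH]; first by rewrite /segment_energy big_ord0 add0r addr0.
rewrite segment_energyS IH -addrA (energy_from_recl _ fx); congr (_ + (_ + _)).
by congr energy_from; lia.
Qed.

Lemma energy_from_signed i n x : finite_energy x ->
  energy_from i x - energy_from (i + n) x = signed_energy i n x.
Proof.
move=> fx; case: n => m /=.
  by rewrite (@energy_from_segment i m)// addrK.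
rewrite NegzE (@energy_from_segment (i - m.+1%:Z) m.+1)// subrK opprD addrC.
by rewrite -addrA addNr addr0.
Qed.

(** The mean of [tail_exp] under the process and its mean along the walk solve the heat equation
    with the same datum, so [heat_unique] identifies them. The factor [e] is the inverse of
    [tail_exp sigma i x] and turns tail energies into energy differences. *)
Lemma current_exp_finiteE i (t : R) x : 0 <= t -> finite_energy x ->
  current_exp_finite sigma P i t x =
  (\int[W (t, 0%R)]_n (expR (2 * sigma * signed_energy i n x))%:E)%E.
Proof.
move=> t0 fx; pose e := expR (2 * sigma * energy_from i x).
have P1 s : (P s setT = 1)%E by exact: prob_kernel.
have W1 s : (W s setT = 1)%E by exact: prob_kernel.
have [[_ _ Pfin] _ _] := abepP.
have iP : (P (t, x)).-integrable setT (EFin \o tail_exp sigma i).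
  apply: (@integrable_ae_bounded _ _ _ _ _ _ 1) => //; first exact: measurable_tail_exp.
  by apply: filterS (Pfin t x t0 fx) => y [y0 _]; exact: tail_exp_norm.
have bW n : `|tail_exp sigma n x| <= 1.
  by apply: tail_exp_norm => //; case: fx.
have iW : (W (t, 0%R)).-integrable setT (EFin \o (fun n => tail_exp sigma (i + n) x)).
  by apply: (@integrable_ae_bounded _ _ _ _ _ _ 1) => //; apply: aeW => n; exact: bW.
transitivity (e%:E * \int[P (t, x)]_y (tail_exp sigma i y)%:E)%E.
  rewrite -integralZl//; apply: eq_integral => y _.
  by rewrite -EFinM -expRD; congr (expR _)%:E; ring.
have -> : (\int[P (t, x)]_y (tail_exp sigma i y)%:E =
    \int[W (t, 0%R)]_n (tail_exp sigma (i + n) x)%:E)%E.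
  rewrite -[LHS]fineK; last exact: integrable_fin_num iP.
  rewrite -[RHS]fineK; last exact: integrable_fin_num iW.
  congr EFin.
  exact: (heat_unique k0 (abep_tail_heat sigma0 k0 abepP fx)
    (walk_heat_solution k0 walkW bW) i t0).
rewrite -integralZl//; apply: eq_integral => n _.
rewrite -EFinM -expRD -energy_from_signed//; congr (expR _)%:E; ring.
Qed.

Lemma restriction_finite_energy L x : nonneg_config x ->
  finite_energy (restriction L x).
Proof.
move=> x0; have r0 : nonneg_config (restriction L x).
  by move=> i; rewrite /restriction; case: ifP => // _; exact: x0.
split=> //; pose A := [set i : int | `|i| <= L%:Z].
have finA : finite_set A.
  apply: (@sub_finite_set _ _ ((fun n : nat => n%:Z - L%:Z) @` `I_(L + L).+1)).
    by move=> i; rewrite /A/= => iL; exists `|(i + L%:Z)%R|%N => /=; lia.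
  by apply: finite_image; exact: finite_II.
rewrite /total_energy (esumID A)//; last by move=> i _; rewrite lee_fin r0.
rewrite setTI setTI [X in (_ + X)%E]esum1 ?adde0; last first.
  by move=> i /= iL; rewrite /restriction; case: ifPn.
rewrite esum_fset//; last by move=> i _; rewrite lee_fin r0.
by rewrite fsumEFin// ltry.
Qed.

Lemma segment_energy_restriction_near i m x :
  \forall L \near \oo, segment_energy i m (restriction L x) = segment_energy i m x.
Proof.
near=> L; apply: eq_bigr => j _; rewrite /restriction ifT//.
have : (`|i| + m <= L)%N by near: L; exact: nbhs_infty_ge.
have := ltn_ord j; lia.
Unshelve. all: by end_near. Qed.

Lemma segment_energy_restriction_homo i m x : nonneg_config x ->
  {homo (fun L => segment_energy i m (restriction L x)) : L M / (L <= M)%N >-> L <= M}.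
Proof.
move=> x0 L M LM; apply: ler_sum => j _; rewrite /restriction.
case: ifPn => jL; last by case: ifP => // _; exact: x0.
by rewrite ifT//; move: jL; lia.
Qed.

Lemma signed_energy_restriction_cvg i n x :
  (expR (2 * sigma * signed_energy i n (restriction L x)))%:E @[L --> \oo] -->
  (expR (2 * sigma * signed_energy i n x))%:E.
Proof.
apply: cvg_near_cst; case: n => m /=.
  by apply: filterS (segment_energy_restriction_near i m x) => L ->.
by apply: filterS (segment_energy_restriction_near (i - m.+1%:Z) m.+1 x) => L ->.
Qed.

(** For [n] nonnegative the integrand increases with the window, so monotone convergence applies
    even to an infinite limit; for negative [n] it is at most 1 and dominated convergence
    applies. *)
Lemma current_exp_finite_cvg i (t : R) x : 0 <= t -> nonneg_config x ->
  current_exp_finite sigma P i t (restriction L x) @[L --> \oo] -->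
  (\int[W (t, 0%R)]_n (expR (2 * sigma * signed_energy i n x))%:E)%E.
Proof.
move=> t0 x0; pose D := [set n : int | 0 <= n].
have mD (A : set int) : measurable A by [].
have W1 s : (W s setT = 1)%E by exact: prob_kernel.
pose g (y : config R) n := (expR (2 * sigma * signed_energy i n y))%:E.
have g0 y n : (0 <= g y n)%E by rewrite lee_fin expR_ge0.
have split y : (\int[W (t, 0%R)]_n g y n =
    \int[W (t, 0%R)]_(n in D) g y n + \int[W (t, 0%R)]_(n in ~` D) g y n)%E.
  by rewrite -ge0_integral_setU ?setUv// /disj_set setICr.
rewrite (_ : (fun L => _) = fun L =>
  (\int[W (t, 0%R)]_(n in D) g (restriction L x) n +
   \int[W (t, 0%R)]_(n in ~` D) g (restriction L x) n)%E); last first.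
  apply/funext => L; rewrite -split current_exp_finiteE//.
  exact: restriction_finite_energy.
rewrite [X in _ --> X](split x).
have bound y : nonneg_config y -> forall n, (~` D) n -> (g y n <= 1)%E.
  move=> y0 [m|m] /= mD'; first by exfalso; apply: mD'.
  rewrite lee_fin -[leRHS]expR0 ler_expR mulrN oppr_le0.
  by rewrite !mulr_ge0 ?segment_energy_ge0// ltW.
have r0 L : nonneg_config (restriction L x) by case: (restriction_finite_energy L x0).
have i1 : (W (t, 0%R)).-integrable (~` D) (cst 1%E).
  apply/integrableP; split=> //=.
  rewrite normr1 integral_cst// mul1e; apply: (@le_lt_trans _ _ 1%E); last exact: ltry.
  by rewrite -(W1 (t, 0%R)); apply: le_measure; rewrite ?inE.
have [||||| iN _ cN] := @dominated_convergence _ _ _ (W (t, 0%R)) (~` D) (mD _)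
  (fun L => g (restriction L x)) (g x) (cst 1%E).
- by [].
- by [].
- by apply: aeW => n _; exact: signed_energy_restriction_cvg.
- exact: i1.
- by apply: aeW => n L nD; rewrite gee0_abs//; exact: bound.
(* The part over negative [n] has a finite limit, so the sum of the two limits is defined even if
   the other one is infinite. *)
apply: cvgeD => //.
  by apply: fin_num_adde_defl; exact: integrable_fin_num iN.
have -> : (\int[W (t, 0%R)]_(n in D) g x n = \int[W (t, 0%R)]_(n in D)
    (limn (fun L => g (restriction L x) n)))%E.
  apply: eq_integral => n _; apply/esym/cvg_lim => //.
  exact: signed_energy_restriction_cvg.
apply: cvg_monotone_convergence => //.
move=> [m|m]//= _ L M LM; rewrite lee_fin ler_expR ler_wpM2l ?mulr_ge0 ?(ltW sigma0)//.
exact: segment_energy_restriction_homo.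
Qed.

Lemma current_expE i (t : R) x : 0 <= t -> nonneg_config x ->
  current_exp sigma P i t x =
  (\int[W (t, 0%R)]_n (expR (2 * sigma * signed_energy i n x))%:E)%E.
Proof. by move=> t0 x0; apply/cvg_lim => //; exact: current_exp_finite_cvg. Qed.

End current_representation.

(** * Product measures *)

(** As [int] is countable, a preimage is a countable union of rectangles, one for each integer,
    enumerated through [unpickle]. *)
Lemma measurable_fun_int_prod d d' (T : measurableType d) (U : measurableType d')
    (f : int * T -> U) :
  (forall n, measurable_fun setT (fun x => f (n, x))) -> measurable_fun setT f.
Proof.
move=> mf _ B mB; rewrite setTI.
rewrite (_ : f @^-1` B = \bigcup_(m : nat)
  (if @unpickle int m is Some n then
     [set n] `*` ((fun x => f (n, x)) @^-1` B) else set0)).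
  apply: bigcupT_measurable => m; case: unpickle => [n|]; last exact: measurable0.
  apply: measurableX; first by [].
  by rewrite -[X in measurable X]setTI; exact: mf.
apply/seteqP; split => [[n x] /= fB|[n x] /= [m _]].
  by exists (pickle n) => //; rewrite pickleK.
by case: unpickle => //= n' [/= -> ].
Qed.

Section kernel_law.
Context d d' (X : measurableType d) (Y : measurableType d') (R : realType)
  (K : R.-pker X ~> Y) (x : X).

(** A copy of [K x] that carries the structure of a probability measure, so that the Fubini-Tonelli
    theorem applies to it. *)
Definition kernel_law : set Y -> \bar R := K x.

HB.instance Definition _ := Measure.on kernel_law.

HB.instance Definition _ :=
  Measure_isProbability.Build _ _ _ kernel_law (prob_kernel x).

End kernel_law.

Section product_measure_theory.
Context {R : realType} (mu : probability (measurableTypeR R) R)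
  (Q : probability (config R) R).
Hypothesis muQ : is_product_measure mu Q.
Implicit Types (x : config R) (i j : int).

(** Resampling of one site: under the product of [mu] and [Q] the new configuration again has law
    [Q], which expresses the independence of the site [j] from all others. *)
Definition replace_coord j (z : measurableTypeR R * config R) : config R :=
  fun l => if l == j then z.1 else z.2 l.

Lemma measurable_config d (T : measurableType d) (f : T -> config R) :
  (forall i, measurable_fun setT (fun z => f z i : measurableTypeR R)) ->
  measurable_fun setT f.
Proof.
move=> mf; apply: (@measurability _ _ T (config R) setT f (@coordinate_sets R)) => //.
move=> _ [A [i [B [mB ->]]] <-].
exact: (mf i measurableT B mB).
Qed.

Lemma measurable_replace_coord j : measurable_fun setT (replace_coord j).
Proof.
apply: measurable_config => i; rewrite /replace_coord; case: (i == j).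
  exact: measurable_fst.
exact: measurableT_comp (measurable_coordinate i) measurable_snd.
Qed.

Definition box (s : seq int) (A : int -> set R) : set (config R) :=
  [set x | forall i, i \in s -> A i (x i)].

Lemma measurable_box s A : (forall i, measurable (A i)) -> measurable (box s A).
Proof.
move=> mA; elim: s => [|i s IH].
  rewrite (_ : box _ _ = setT); first exact: measurableT.
  by apply/seteqP; split.
rewrite (_ : box _ _ = (fun x => x i) @^-1` A i `&` box s A).
  apply: measurableI => //; rewrite -[X in measurable X]setTI.
  exact: (measurable_coordinate i measurableT (mA i)).
apply/seteqP; split => [x xs|x [xi xs] l].
  split; first by apply: xs; rewrite inE eqxx.
  by move=> l ls; apply: xs; rewrite inE ls orbT.
by rewrite inE => /predU1P[->|/xs].
Qed.

(** The finite-dimensional rectangles: a generating family closed under intersection, on which the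
    values of [Q] are prescribed. *)
Let boxes := [set B | exists s A,
  [/\ uniq s, forall i, measurable (A i) & B = box s A]].

Let setI_boxes : setI_closed boxes.
Proof.
move=> _ _ [s [A [us mA ->]]] [s' [A' [us' mA' ->]]].
exists (undup (s ++ s')), (fun i => (if i \in s then A i else setT) `&`
  (if i \in s' then A' i else setT)); split; first exact: undup_uniq.
  by move=> i; apply: measurableI; case: ifP.
apply/seteqP; split => [x [xs xs'] i|x xss].
  rewrite mem_undup mem_cat => _; split; case: ifP => // ; [exact: xs|exact: xs'].
split=> i is_.
  have := xss i; rewrite mem_undup mem_cat is_ => /(_ isT)[].
  by [].
have := xss i; rewrite mem_undup mem_cat is_ orbT => /(_ isT)[].
by [].
Qed.

Let boxes_sigma : (<<s @coordinate_sets R >> = <<s boxes >>).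
Proof.
apply/seteqP; split.
  apply: smallest_sub; first exact: smallest_sigma_algebra.
  move=> _ [i [B [mB ->]]]; apply: sub_sigma_algebra.
  exists [:: i], (fun=> B); split => //.
  apply/seteqP; split => x /=; first by move=> Bx l; rewrite inE => /eqP ->.
  by apply; rewrite inE.
apply: smallest_sub; first exact: smallest_sigma_algebra.
by move=> _ [s [A [us mA ->]]]; exact: measurable_box.
Qed.

(** By uniqueness of measures it suffices to compare on boxes. If [j] is constrained, its factor
    comes from the fresh coordinate and the others from [Q]; otherwise the fresh coordinate
    contributes 1. *)
Lemma replace_coord_measure j (A : set (config R)) : measurable A ->
  pushforward (mu \x Q)%E (replace_coord j) A = Q A.
Proof.
move=> mA; apply: (measure_unique boxes (fun=> setT)) => //.
- by move=> _; exists [::], (fun=> setT); split => //; apply/seteqP; split.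
- by rewrite bigcup_const.
- exact: measurable_replace_coord.
- move=> mj _ [s [B [us mB ->]]]; rewrite /= /pushforward.
  have -> : replace_coord j @^-1` box s B =
      (if j \in s then B j else setT) `*` box (rem j s) B.
    apply/seteqP; split=> [[y x] /= H|[y x] /= [Hy Hx] l ls].
      split => /=.
        by case: ifP => // js; have := H j js; rewrite /replace_coord eqxx.
      move=> l; rewrite mem_rem_uniq// inE => /andP[lj ls].
      by have := H l ls; rewrite /replace_coord (negbTE lj).
    rewrite /replace_coord/=; case: eqP => [e|/eqP lj]; first by move: Hy; rewrite -e ls.
    by apply: Hx; rewrite mem_rem_uniq// inE lj.
  rewrite product_measure1E//; last 2 first.
  - by case: ifP => _; [exact: mB|exact: measurableT].
  - exact: measurable_box.
  have muB s' : uniq s' -> Q (box s' B) = (\prod_(i <- s') mu (B i))%E.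
    by move=> us'; exact: muQ.
  rewrite [RHS]muB//.
  transitivity (mu (if j \in s then B j else setT) *
      \prod_(i <- rem j s) mu (B i))%E.
    by apply: congr1; apply: muB; exact: rem_uniq.
  case: ifPn => js.
    by rewrite [RHS](perm_big _ (perm_to_rem js)) big_cons.
  rewrite rem_id// (_ : mu _ = 1%E) ?mul1e//.
  exact: (@probability_setT _ _ _ mu).
- by move=> mj _; rewrite /= /pushforward preimage_setT probability_setT ltry.
Qed.

(** Resampling the site [j] leaves [Q] invariant and does not change [G], after which Tonelli's
    theorem separates the two factors. *)
Lemma integral_product_factor j (g : R -> \bar R) (G : config R -> \bar R) :
  measurable_fun setT g -> measurable_fun setT G ->
  (forall y, 0 <= g y)%E -> (forall x, 0 <= G x)%E ->
  (forall y x, G (replace_coord j (y, x)) = G x) ->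
  (\int[Q]_x (g (x j) * G x) = \int[mu]_y g y * \int[Q]_x G x)%E.
Proof.
move=> mg mG g0 G0 GE.
have mgj : measurable_fun setT (fun x : config R => g (x j)).
  exact: measurableT_comp mg (measurable_coordinate j).
have mF : measurable_fun setT (fun x : config R => g (x j) * G x)%E.
  exact: emeasurable_funM.
have F0 (x : config R) : (0 <= g (x j) * G x)%E by rewrite mule_ge0.
transitivity (\int[pushforward (mu \x Q)%E (replace_coord j)]_x (g (x j) * G x))%E.
  apply: eq_measure_integral; first exact: measurable_replace_coord.
  by move=> mj A mA _; rewrite /= replace_coord_measure.
rewrite ge0_integral_pushforward//; last exact: measurable_replace_coord.
rewrite preimage_setT fubini_tonelli1; last 2 first.
- exact: measurableT_comp mF (measurable_replace_coord j).
- by move=> z; exact: F0.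
rewrite /fubini_F/=.
under eq_integral => y _.
  under eq_integral do rewrite {1}/replace_coord/= eqxx GE.
  rewrite ge0_integralZl//.
  over.
rewrite ge0_integralZr//.
by apply: integral_ge0.
Qed.

End product_measure_theory.

Section product_moments.
Context {R : realType} (mu : probability (measurableTypeR R) R)
  (Q : probability (config R) R).
Hypothesis muQ : is_product_measure mu Q.
Implicit Types (x : config R) (i n : int).

(** The sites are independent, and the last one is split off at each step. The identity is one of
    extended reals and includes infinite exponential moments. *)
Lemma exp_segment_moment (c : R) i m :
  (\int[Q]_x (expR (c * segment_energy i m x))%:E = exp_moment mu c ^+ m)%E.
Proof.
elim: m => [|m IH].
  under eq_integral do rewrite /segment_energy big_ord0 mulr0 expR0.
  by rewrite integral_cst// mul1e; exact: probability_setT.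
under eq_integral do rewrite segment_energyS mulrDr expRD mulrC EFinM.
rewrite (@integral_product_factor _ _ _ muQ (i + m%:Z) (fun y => (expR (c * y))%:E)
  (fun x => (expR (c * segment_energy i m x))%:E)).
- by rewrite IH expeS.
- by apply/measurable_EFinP; apply: measurableT_comp => //; exact: measurable_funM.
- apply/measurable_EFinP; apply: measurableT_comp => //.
  by apply: measurable_funM => //; exact: measurable_segment_energy.
- by move=> y; rewrite lee_fin expR_ge0.
- by move=> x; rewrite lee_fin expR_ge0.
- move=> y x; congr (expR (_ * _))%:E; apply: eq_bigr => l _.
  by rewrite /replace_coord; case: eqP => // /addrI []; have := ltn_ord l; lia.
Qed.

Lemma measurable_nonneg_config : measurable (@nonneg_config R).
Proof.
have mi i : measurable [set x : config R | 0 <= x i].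
  have mB : measurable [set y : R | 0 <= y].
    by rewrite -set_itvcy.
  have := @measurable_coordinate R i measurableT _ mB.
  by rewrite setTI.
rewrite (_ : nonneg_config = (\bigcap_(n : nat) [set x : config R | 0 <= x n%:Z]) `&`
    (\bigcap_(n : nat) [set x : config R | 0 <= x (- n%:Z)])).
  by apply: measurableI; apply: bigcapT_measurable => n.
apply/seteqP; split=> [x x0|x [x1 x2] [m|m]]; first by split => n _; exact: x0.
  exact: x1.
by rewrite NegzE; exact: x2.
Qed.

Lemma ae_nonneg_config : mu [set y : R | 0 <= y] = 1%E ->
  {ae Q, forall x, nonneg_config x}.
Proof.
move=> mu1.
have aei i : {ae Q, forall x : config R, 0 <= x i}.
  have mB : measurable [set y : R | 0 <= y] by rewrite -set_itvcy.
  have mi := @measurable_coordinate R i measurableT _ mB; rewrite setTI in mi.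
  exists (~` [set x : config R | 0 <= x i]); split => //; first exact: measurableC.
  have := probability_setC Q mi => ->.
  have -> : Q ((fun x => x i) @^-1` [set y | 0 <= y]) = 1%E; last by rewrite subee.
  have := @muQ [:: i] (fun=> [set y : R | 0 <= y]) isT (fun=> mB).
  rewrite big_seq1 mu1 => <-; congr (Q _); apply/seteqP; split => x /=.
    by move=> xi l; rewrite inE => /eqP ->.
  by apply; rewrite inE.
have ae1 := @ae_foralln _ _ _ Q _ (fun n : nat => aei n%:Z).
have ae2 := @ae_foralln _ _ _ Q _ (fun n : nat => aei (- n%:Z)).
apply: filterS2 ae1 ae2 => x x1 x2 [m|m]; first exact: x1.
by rewrite NegzE; exact: x2.
Qed.

End product_moments.

(** * Reflection of the walk and the averaged current *)

Lemma walk_integral_opp (R : realType) (k : R)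
    (W : R.-pker (measurableTypeR R * int) ~> int) (t : R) (D : set int)
    (f : int -> \bar R) :
  0 <= k -> symmetric_walk k W -> 0 <= t -> (forall n, 0 <= f n)%E ->
  (\int[W (t, 0%R)]_(n in -%R @^-1` D) f (- n)%R =
   \int[W (t, 0%R)]_(n in D) f n)%E.
Proof.
move=> k0 walkW t0 f0.
have mopp : measurable_fun [set: int] (-%R : int -> int) by [].
rewrite -[LHS](ge0_integral_pushforward mopp (W (t, 0%R)))//.
apply: eq_measure_integral => A _ _.
exact: (walk_symmetric k0 walkW).
Qed.

Section signed_power.
Context {R : realType} (a b : \bar R).

(** The mean of the exponential of the signed energy over [n] sites, for suitable [a] and [b]. As
    [Negz m] stands for minus [m.+1], the exponent there is [m.+1]. *)
Definition signed_power (n : int) : \bar R :=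
  match n with Posz m => a ^+ m | Negz m => b ^+ m.+1 end%E.

Lemma signed_power_ge0 n : (0 <= a)%E -> (0 <= b)%E -> (0 <= signed_power n)%E.
Proof. by move=> a0 b0; case: n => m; exact: expe_ge0. Qed.

Lemma signed_power_pos (n : int) : 1 <= n -> signed_power n = (a ^+ `|n|%N)%E.
Proof. by case: n. Qed.

Lemma signed_power_opp (n : int) : 1 <= n -> signed_power (- n) = (b ^+ `|n|%N)%E.
Proof. by case: n => [[|m]|m]. Qed.

End signed_power.

(** The integers split into 0, the positive and the negative ones; the reflection symmetry of the
    walk folds the negative half-line onto the positive one. *)
Lemma walk_signed_power_moment (R : realType) (k : R)
    (W : R.-pker (measurableTypeR R * int) ~> int) (t : R) (a b : \bar R) :
  0 <= k -> symmetric_walk k W -> 0 <= t -> (0 <= a)%E -> (0 <= b)%E ->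
  (\int[W (t, 0%R)]_n signed_power a b n = W (t, 0%R) [set 0%R] +
   \int[W (t, 0%R)]_(n in [set n : int | (1 <= n)%R])
     (a ^+ `|n|%N + b ^+ `|n|%N))%E.
Proof.
move=> k0 walkW t0 a0 b0.
have mD (A : set int) : measurable A by [].
have pow0 n : (0 <= signed_power a b n)%E by exact: signed_power_ge0.
pose D1 := [set n : int | 1 <= n].
have -> : [set: int] = [set 0] `|` (D1 `|` -%R @^-1` D1).
  by apply/seteqP; split => n //= _; rewrite /D1/=; lia.
rewrite ge0_integral_setU//; last first.
  by apply/disj_setPS => n /= [->]; rewrite /D1/=; lia.
rewrite (@eq_integral _ _ _ _ _ (cst 1%E) (signed_power a b)) => [|n]; last first.
  by rewrite inE => ->.
rewrite integral_cst// mul1e; congr (_ + _)%E.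
rewrite ge0_integral_setU//; last first.
  by apply/disj_setPS => n /= []; rewrite /D1/=; lia.
rewrite ge0_integralD//; try by move=> n _; exact: expe_ge0.
congr (_ + _)%E.
  by apply: eq_integral => n; rewrite inE; exact: signed_power_pos.
rewrite -(walk_integral_opp D1 k0 walkW t0); last by move=> n; exact: expe_ge0.
apply: eq_integral => n; rewrite inE => n1.
by have := @signed_power_opp R a b (- n) n1; rewrite opprK.
Qed.

Section current_product.
Context {R : realType} (sigma k : R) (mu : probability (measurableTypeR R) R)
  (Q : probability (config R) R)
  (P : R.-pker (measurableTypeR R * config R) ~> config R)
  (W : R.-pker (measurableTypeR R * int) ~> int).
Hypothesis sigma0 : 0 < sigma.
Hypothesis k0 : 0 <= k.
Hypothesis mu1 : mu [set y : R | 0 <= y] = 1%E.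
Hypothesis muQ : is_product_measure mu Q.
Hypothesis abepP : is_abep sigma k P.
Hypothesis walkW : symmetric_walk k W.

Let lambda_p := exp_moment mu (2 * sigma).
Let lambda_m := exp_moment mu (- (2 * sigma)).

Let lambda_p_ge0 : (0 <= lambda_p)%E.
Proof. by apply: integral_ge0 => y _; rewrite lee_fin expR_ge0. Qed.

Let lambda_m_ge0 : (0 <= lambda_m)%E.
Proof. by apply: integral_ge0 => y _; rewrite lee_fin expR_ge0. Qed.

Let moment := signed_power lambda_p lambda_m.

Let moment_ge0 n : (0 <= moment n)%E.
Proof. exact: signed_power_ge0. Qed.

Lemma exp_signed_moment i n :
  (\int[Q]_x (expR (2 * sigma * signed_energy i n x))%:E = moment n)%E.
Proof.
case: n => m; first exact: (exp_segment_moment muQ).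
rewrite -[RHS](exp_segment_moment muQ _ (i - m.+1%:Z)).
by apply: eq_integral => x _; rewrite mulNr -mulrN.
Qed.

(** Tonelli's theorem exchanges the average over the initial configuration with the average over the
    walk, and for a fixed walk position the former is a product of single-site moments. *)
Lemma current_exp_product_moment i (t : R) : 0 <= t ->
  current_exp_product sigma P Q i t = (\int[W (t, 0%R)]_n moment n)%E.
Proof.
move=> t0.
pose f (z : int * config R) := (expR (2 * sigma * signed_energy i z.1 z.2))%:E.
have mf : measurable_fun setT f.
  apply: measurable_fun_int_prod => n.
  apply/measurable_EFinP; apply: measurableT_comp => //.
  apply: measurable_funM => //; case: n => m; first exact: measurable_segment_energy.
  by apply: measurable_funN; exact: measurable_segment_energy.
have f0 z : (0 <= f z)%E by rewrite lee_fin expR_ge0.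
have -> : current_exp_product sigma P Q i t =
    (\int[Q]_x \int[kernel_law W (t, 0%R)]_n f (n, x))%E.
  transitivity (\int[Q]_(x in nonneg_config) \int[kernel_law W (t, 0%R)]_n f (n, x))%E.
    apply: eq_integral => x; rewrite inE => x0.
    exact: (current_expE sigma0 k0 abepP walkW).
  (* Almost every configuration is nonnegative, so the domain of integration can be enlarged to the
     whole space. *)
  have [N [mN N0 sN]] := ae_nonneg_config muQ mu1.
  have mF : measurable_fun setT (fun x => \int[kernel_law W (t, 0%R)]_n f (n, x))%E.
    exact: (@measurable_fun_fubini_tonelli_G _ _ _ _ _ (kernel_law W (t, 0%R)) f mf f0).
  have F0 x : (0 <= \int[kernel_law W (t, 0%R)]_n f (n, x))%E by exact: integral_ge0.
  rewrite (ge0_negligible_integral mN)//; last 2 first.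
  - exact: measurable_nonneg_config.
  - exact: measurable_funTS.
  rewrite [RHS](ge0_negligible_integral mN)//.
  congr integral; apply/seteqP; split => x [x0 xN]; split => //.
  by apply: contrapT => nx; apply: xN; apply: sN.
rewrite -(fubini_tonelli f)//; apply: eq_integral => n _.
exact: exp_signed_moment.
Qed.

Lemma current_exp_productE i (t : R) : 0 <= t ->
  current_exp_product sigma P Q i t =
  (W (t, 0%R) [set 0%R] +
   \int[W (t, 0%R)]_(n in [set n : int | (1 <= n)%R])
     (lambda_p ^+ `|n|%N + lambda_m ^+ `|n|%N))%E.
Proof.
move=> t0; rewrite current_exp_product_moment//.
exact: (walk_signed_power_moment k0 walkW).
Qed.

End current_product.

(** * The rate function *)

Section rate_function.
Context {R : realType} (k : R).

Let root (x : R) := Num.sqrt (x ^+ 2 + (4 * k) ^+ 2).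

(** The hyperbolic substitution [x = 4 * k * sinh (ln r)], which removes the square root from the
    rate function. *)
Let rate_param x : 0 < k -> 0 <= x ->
  exists r, [/\ 0 < r, (4 * k)^-1 * (x + root x) = r,
    x = 2 * k * (r - r^-1) & root x = 2 * k * (r + r^-1)].
Proof.
move=> kp x0; pose s := root x.
have s2 : s ^+ 2 = x ^+ 2 + (4 * k) ^+ 2.
  by rewrite /s /root sqr_sqrtr// addr_ge0// sqr_ge0.
have k4 : 0 < 4 * k by rewrite mulr_gt0.
have s0 : 0 < s.
  by rewrite sqrtr_gt0 ltr_wpDl ?sqr_ge0// exprn_gt0.
have xs : 0 < x + s by rewrite ltr_wpDl.
have k4n : 4 * k != 0 by rewrite gt_eqF.
have r0 : 0 < (4 * k)^-1 * (x + s) by rewrite mulr_gt0// invr_gt0.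
have rV : ((4 * k)^-1 * (x + s))^-1 = (4 * k)^-1 * (s - x).
  apply: (mulIf (lt0r_neq0 r0)); rewrite mulVf ?gt_eqF// mulrACA.
  have -> : (s - x) * (x + s) = (4 * k) ^+ 2 by ring: s2.
  by rewrite -invfM -expr2 mulVf// expf_neq0.
have kn : k != 0 by rewrite gt_eqF.
exists ((4 * k)^-1 * (x + s)); split => //; rewrite rV.
  by field.
by rewrite -/s; field.
Qed.

Lemma rate_posE x : 0 < k -> rate k x =
  (4 * k - root x + x * ln ((4 * k)^-1 * (x + root x)))%:E.
Proof. by move=> kp; rewrite /rate gt_eqF. Qed.

(** With [lam = q * r] the difference of the two sides is [2 * k] times the sum of
    [r * (q - 1 - ln q)] and [r^-1 * (q^-1 - 1 + ln q)], both nonnegative because the logarithm lies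
    below its tangent at 1. *)
Lemma rate_legendre_le x lam : 0 < k -> 0 < lam -> 0 <= x ->
  ((x * ln lam)%:E - rate k x <= (walk_exponent k lam)%:E)%E.
Proof.
move=> kp lam0 x0; rewrite rate_posE// lee_fin.
have [r [r0 -> xE ->]] := rate_param kp x0.
pose q := lam / r.
have q0 : 0 < q by rewrite divr_gt0.
have lamE : lam = q * r by rewrite divfK// gt_eqF.
have ln_le (y : R) : 0 < y -> ln y <= y - 1.
  by move=> y0; rewrite -{1}(subrKC 1 y) le_ln1Dx// ltrBrDl subrr.
have l1 := ln_le _ q0.
have l2 := ln_le q^-1; rewrite invr_gt0 lnV// in l2; have {}l2 := l2 q0.
have lamV : lam^-1 = q^-1 * r^-1 by rewrite lamE invfM.
rewrite /walk_exponent lamV [in leLHS]lamE lnM// lamE.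
have m1 : r * ln q <= r * (q - 1) by rewrite ler_wpM2l// ltW.
have m2 : r^-1 * - ln q <= r^-1 * (q^-1 - 1) by rewrite ler_wpM2l// invr_ge0 ltW.
rewrite -subr_ge0 xE.
have -> : 2 * k * (q * r + q^-1 * r^-1 - 2) -
    (2 * k * (r - r^-1) * (ln q + ln r) -
      (4 * k - 2 * k * (r + r^-1) + 2 * k * (r - r^-1) * ln r)) =
    2 * k * ((r * (q - 1) - r * ln q) + (r^-1 * (q^-1 - 1) - r^-1 * - ln q)) by ring.
by rewrite !mulr_ge0 ?(ltW kp)// addr_ge0// subr_ge0.
Qed.

(** The maximiser corresponds to the parameter [r = lam]; it is nonnegative because [lam] is at
    least 1. *)
Lemma rate_legendre_eq lam : 0 < k -> 1 <= lam ->
  exists2 x, 0 <= x & ((x * ln lam)%:E - rate k x = (walk_exponent k lam)%:E)%E.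
Proof.
move=> kp lam1; have lam0 : 0 < lam by exact: lt_le_trans lam1.
have lamn : lam != 0 by rewrite gt_eqF.
exists (2 * k * (lam - lam^-1)).
  by rewrite !mulr_ge0 ?(ltW kp)// subr_ge0 (le_trans _ lam1)// invf_le1.
rewrite rate_posE//.
have -> : root (2 * k * (lam - lam^-1)) = 2 * k * (lam + lam^-1).
  rewrite /root (_ : _ + _ = (2 * k * (lam + lam^-1)) ^+ 2); last by field.
  by rewrite sqrtr_sqr ger0_norm// !mulr_ge0 ?(ltW kp)// addr_ge0 ?invr_ge0 ?(ltW lam0).
have -> : (4 * k)^-1 * (2 * k * (lam - lam^-1) + 2 * k * (lam + lam^-1)) = lam.
  by field; rewrite lamn gt_eqF.
by congr EFin; rewrite /walk_exponent; ring.
Qed.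

Hypothesis k0 : 0 <= k.

Lemma rate0 : rate k 0 = 0%E.
Proof.
move: k0; rewrite le_eqVlt => /predU1P[<-|kp]; first by rewrite /rate !eqxx.
rewrite rate_posE// mul0r addr0 /root expr0n/= add0r sqrtr_sqr ger0_norm ?subrr//.
by rewrite mulr_ge0.
Qed.

(** For [0 < k] this is the Legendre inequality at [lam = 1], where the exponent vanishes. *)
Lemma rate_ge0 x : 0 <= x -> (0 <= rate k x)%E.
Proof.
move: k0; rewrite le_eqVlt => /predU1P[<-|kp] x0.
  by rewrite /rate eqxx; case: ifP.
have := @rate_legendre_le x 1 kp ltr01 x0.
rewrite ln1 mulr0 /walk_exponent invr1 (_ : 1 + 1 - 2 = 0) ?mulr0; last by ring.
by rewrite rate_posE// !lee_fin sub0r oppr_le0.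
Qed.

Lemma ereal_inf_rate :
  ereal_inf [set rate k x | x in [set x : R | (0 <= x)%R]] = 0%E.
Proof.
apply/eqP; rewrite eq_le; apply/andP; split.
  by apply: ereal_inf_lbound; exists 0; rewrite ?rate0//=.
by apply: le_ereal_inf_tmp => _ [x x0 <-]; exact: rate_ge0.
Qed.

Lemma ereal_sup_rate_fin lam : 1 <= lam ->
  ereal_sup [set (x%:E * lne lam%:E - rate k x)%E | x in [set x : R | (0 <= x)%R]] =
  (walk_exponent k lam)%:E.
Proof.
have k_cases : 0 = k \/ 0 < k by move: k0; rewrite le_eqVlt => /predU1P.
move=> lam1; have lam0 : 0 < lam by exact: lt_le_trans lam1.
apply/eqP; rewrite eq_le; apply/andP; split.
  apply: ge_ereal_sup => _ [x x0 <-]; rewrite lne_EFin// -EFinM.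
  case: k_cases => [ke|kp]; last exact: rate_legendre_le.
  rewrite /rate -ke eqxx /walk_exponent mulr0 mul0r; case: eqP => [->|_].
    by rewrite mul0r sube0.
  by rewrite /= leNye.
case: k_cases => [ke|kp].
  apply: ereal_sup_ubound; exists 0 => //=.
  by rewrite mul0e rate0 sube0 /walk_exponent -ke mulr0 mul0r.
have [x x0 xE] := rate_legendre_eq kp lam1.
by apply: ereal_sup_ubound; exists x => //; rewrite lne_EFin// -EFinM.
Qed.

(** For [k = 0] the conventions matter: the product of 0 and [+oo] is 0, and [+oo - +oo] is [-oo],
    so only [x = 0] counts. For [0 < k] the point [x = 1] already gives [+oo]. *)
Lemma ereal_sup_rate_pinfty :
  ereal_sup [set (x%:E * lne +oo - rate k x)%E | x in [set x : R | (0 <= x)%R]] =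
  if k == 0 then 0%E else +oo%E.
Proof.
case: ifPn => [/eqP ke|kn].
  apply/eqP; rewrite eq_le; apply/andP; split.
    apply: ge_ereal_sup => _ [x x0 <-].
    rewrite /rate ke eqxx; case: eqP => [->|_]; first by rewrite mul0e sube0.
    by rewrite /= addeC leNye.
  by apply: ereal_sup_ubound; exists 0 => //=; rewrite mul0e rate0 sube0.
have kp : 0 < k by rewrite lt_neqAle eq_sym kn.
apply/eqP; rewrite eq_le leey/=; apply: ereal_sup_ubound; exists 1 => //=.
by rewrite mul1e rate_posE.
Qed.

End rate_function.

(** * Long-time asymptotics *)

Section walk_moment_asymptotics.
Context {R : realType} (k : R) (W : R.-pker (measurableTypeR R * int) ~> int).
Hypothesis k0 : 0 <= k.
Hypothesis walkW : symmetric_walk k W.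

Let W1 s : (W s setT = 1)%E. Proof. exact: prob_kernel. Qed.

Let mD (A : set int) : measurable A. Proof. by []. Qed.

(** The right-hand side of the current formula with free bases, so that the second can be varied
    independently of the first. *)
Definition walk_moment (a b : \bar R) (t : R) : \bar R :=
  (W (t, 0%R) [set 0%R] + \int[W (t, 0%R)]_(n in [set n : int | (1 <= n)%R])
     (a ^+ `|n|%N + b ^+ `|n|%N))%E.

(** For inverse bases the signed power is [lam ^ n], so this is the exponential moment of the
    walk. *)
Lemma walk_moment_inv (lam t : R) : 1 <= lam -> 0 <= t ->
  walk_moment lam%:E (lam^-1)%:E t = (expR (walk_exponent k lam * t))%:E.
Proof.
move=> lam1 t0; have lam0 : 0 < lam by exact: lt_le_trans lam1.
rewrite /walk_moment -(walk_signed_power_moment k0 walkW t0)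
  ?lee_fin ?invr_ge0 ?(ltW lam0)//.
rewrite -(walk_exp_momentE k0 walkW lam1 t0) /Rintegral fineK; last first.
  rewrite ge0_fin_numE; last first.
    by apply: integral_ge0 => n _; rewrite lee_fin exprz_ge0// ltW.
  by apply: le_lt_trans (walk_exp_moment_le k0 walkW lam1 t0) _; rewrite ltry.
by apply: eq_integral => -[m|m] _; rewrite /signed_power -EFin_expe// exprVn.
Qed.

(** Powers of [b] are at most 1 and powers of [lam] at least 1, so the second base affects the
    integrand by at most a factor 2. *)
Lemma walk_moment_comparable (lam b b' t : R) : 1 <= lam -> 0 <= b <= 1 -> 0 <= b' ->
  (walk_moment lam%:E b%:E t <= 2%:E * walk_moment lam%:E b'%:E t)%E.
Proof.
move=> lam1 /andP[b0 b1] b'0; have lam0 : 0 < lam by exact: lt_le_trans lam1.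
have p0 (a : R) m : 0 <= a -> (0 <= a%:E ^+ m)%E by move=> a0; exact: expe_ge0.
have i0 (c : R) : 0 <= c -> (0 <= \int[W (t, 0%R)]_(n in [set n : int | (1 <= n)%R])
     (lam%:E ^+ `|n|%N + c%:E ^+ `|n|%N))%E.
  by move=> c0; apply: integral_ge0 => n _; rewrite adde_ge0// p0// ltW.
rewrite /walk_moment muleDr//; last by rewrite ge0_adde_def// inE ?i0.
apply: leeD.
  by rewrite lee_pemull// lee_fin ler1n.
rewrite -ge0_integralZl//; last by move=> n _; rewrite adde_ge0// p0// ltW.
apply: ge0_le_integral => //.
  by move=> n _; rewrite adde_ge0// p0// ltW.
move=> n _; rewrite -!EFin_expe -!EFinD -EFinM lee_fin.
have bm : b ^+ `|n|%N <= 1 by rewrite exprn_ile1.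
have lm : 1 <= lam ^+ `|n|%N by rewrite exprn_ege1.
have b'm : 0 <= b' ^+ `|n|%N by rewrite exprn_ge0.
by lra.
Qed.

(** If the positive half-line were null, the moment with bases 2 and 1/2 would be at most 1, whereas
    it is an exponential with positive exponent. *)
Lemma walk_positive_side (t : R) : 0 < k -> 0 < t ->
  (0 < W (t, 0%R) [set n : int | (1 <= n)%R])%E.
Proof.
move=> kp t0; rewrite lt0e measure_ge0 andbT; apply/eqP => D0.
have := walk_moment_inv (ler1n R 2) (ltW t0).
rewrite /walk_moment null_set_integral// adde0 => E.
have : (W (t, 0%R) [set 0%R] <= 1)%E.
  by rewrite -(W1 (t, 0%R)); apply: le_measure; rewrite ?inE.
rewrite E lee_fin -expR0 ler_expR leNgt mulr_gt0//.
by rewrite /walk_exponent mulr_gt0 ?mulr_gt0//; lra.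
Qed.

Lemma walk_moment_pinfty (b : \bar R) (t : R) : 0 < k -> 0 < t -> (0 <= b)%E ->
  walk_moment +oo b t = +oo%E.
Proof.
move=> kp t0 b0.
rewrite /walk_moment (@eq_integral _ _ _ _ _ (cst +oo%E)) => [|n]; last first.
  rewrite inE => n1; have [m ->] : exists m : nat, `|n|%N = m.+1.
    by exists `|n|.-1%N; move: n1 => /=; lia.
  rewrite expeS gt0_mulye; last by apply: expe_gt0; exact: lt0y.
  by rewrite addye// gt_eqF// (lt_le_trans _ (expe_ge0 _ b0))// ltNy0.
rewrite integral_cst// gt0_mulye ?walk_positive_side// addey//.
by rewrite gt_eqF// (lt_le_trans ltNy0).
Qed.

(** For [k = 0] the generator vanishes; tested on the indicator of 0 this shows that the walk stays
    at 0, so the integral over the positive half-line is zero. *)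
Lemma walk_moment_frozen (a b : \bar R) (t : R) : k = 0 -> 0 <= t ->
  walk_moment a b t = 1%E.
Proof.
move=> kE t0.
have M1 (n : int) : `|\1_[set 0%R] n : R| <= 1.
  by rewrite indicE; case: (_ \in _); rewrite ?normr0 ?normr1.
have := walk_mean k0 walkW (0 : int) M1 t0.
rewrite (@eq_Rintegral _ _ _ lebesgue_measure _ (cst 0)); last first.
  move=> s _; rewrite (@eq_Rintegral _ _ _ _ _ (cst 0)).
    by rewrite Rintegral_cst// mul0r.
  by move=> n _; rewrite /walk_generator kE mulr0 !mul0r addr0.
rewrite Rintegral_cst// mul0r addr0 indicE mem_set// /Rintegral => E.
have W0 : W (t, 0%R) [set 0%R] = 1%E.
  have -> : W (t, 0%R) [set 0%R] = (\int[W (t, 0%R)]_m (\1_[set 0%R] m)%:E)%E.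
    by rewrite integral_indic// setIT.
  rewrite -[LHS]fineK ?E//.
  apply: integrable_fin_num => //.
  by apply: (integrable_ae_bounded (W1 _) _ (aeW _ M1)).
rewrite /walk_moment W0 null_set_integral// ?adde0//.
apply/eqP; rewrite -measure_le0 -(@leeD2lE _ 1%E)// adde0.
rewrite -{1}W0 -measureU//.
  by rewrite -(W1 (t, 0%R)); apply: le_measure; rewrite ?inE.
by apply/seteqP; split => n //= [->].
Qed.

End walk_moment_asymptotics.

(** After taking logarithms, the factors 2 shift the quotient by at most [ln 2 / t]. *)
Lemma cvg_ln_div_exp_bounds (R : realType) (v : R -> R) (phi : R) :
  (forall t, 0 < t -> expR (phi * t) <= 2 * v t /\ v t <= 2 * expR (phi * t)) ->
  (fun t => t^-1 * ln (v t)) @ +oo --> phi.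
Proof.
move=> vb.
have V0 : (fun t : R => t^-1) @ +oo --> (0 : R).
  apply/gtr0_cvgV0; last exact: cvg_id.
  exact: nbhs_pinfty_gt.
have cl (c : R) : (fun t : R => phi + t^-1 * c) @ +oo --> phi.
  rewrite -[X in _ --> X]addr0 -[X in _ --> _ + X](mul0r c).
  by apply: cvgD; [exact: cvg_cst|apply: cvgMl].
apply: (squeeze_cvgr _ (cl (- ln 2)) (cl (ln 2))).
near=> t; have t0 : 0 < t by near: t; exact: nbhs_pinfty_gt.
have [v1 v2] := vb t t0.
have v0 : 0 < v t by rewrite -(pmulr_rgt0 _ (ltr0n R 2)) (lt_le_trans (expR_gt0 _) v1).
have lnE (c : R) : t^-1 * (phi * t + c) = phi + t^-1 * c.
  by rewrite mulrDr mulrCA mulVf ?mulr1// gt_eqF.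
rewrite -!lnE !ler_pM2l ?invr_gt0//; apply/andP; split.
  rewrite lerBlDl -lnM ?posrE//.
  by rewrite -[leLHS]expRK ler_ln// ?posrE ?expR_gt0// mulr_gt0.
rewrite addrC -[X in _ <= _ + X]expRK -lnM ?posrE ?expR_gt0//.
by rewrite ler_ln// ?posrE// mulr_gt0// expR_gt0.
Unshelve. all: by end_near. Qed.

Section exp_moment_bounds.
Context {R : realType} (mu : probability (measurableTypeR R) R).
Hypothesis mu1 : mu [set y : R | 0 <= y] = 1%E.

Let ae0 : {ae mu, forall y : R, 0 <= y}.
Proof.
have mB : measurable [set y : R | 0 <= y] by rewrite -set_itvcy.
exists (~` [set y : R | 0 <= y]); split => //; first exact: measurableC.
have := probability_setC mu mB => ->.
by rewrite mu1 subee.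
Qed.

Let mexp (c : R) : measurable_fun setT (fun y : measurableTypeR R => (expR (c * y))%:E).
Proof.
by apply/measurable_EFinP; apply: measurableT_comp => //; exact: measurable_funM.
Qed.

Let one : (\int[mu]_y 1 = 1)%E.
Proof. by rewrite integral_cst// mul1e; exact: probability_setT. Qed.

Lemma exp_moment_ge1 c : 0 <= c -> (1 <= exp_moment mu c)%E.
Proof.
move=> c0; rewrite -one; apply: ae_ge0_le_integral => //.
have [N [mN N0 sN]] := ae0; exists N; split=> // y /= yN; apply: sN => y0; apply: yN => _.
by rewrite lee_fin -expR0 ler_expR mulr_ge0.
Qed.

Lemma exp_moment_le1 c : c <= 0 -> (exp_moment mu c <= 1)%E.
Proof.
move=> c0; rewrite -one; apply: ae_ge0_le_integral => //.
have [N [mN N0 sN]] := ae0; exists N; split=> // y /= yN; apply: sN => y0; apply: yN => _.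
by rewrite lee_fin -expR0 ler_expR mulr_le0_ge0.
Qed.

Lemma exp_moment_ge0 c : (0 <= exp_moment mu c)%E.
Proof. by apply: integral_ge0 => y _; rewrite lee_fin expR_ge0. Qed.

End exp_moment_bounds.

(** For finite [a] the moment is compared in both directions with the one where [b] is the inverse
    of [a], which is an explicit exponential. For infinite [a] it is constantly 1 if [k = 0] and
    [+oo] at all positive times otherwise, in agreement with the supremum. *)
Lemma walk_moment_log_cvg (R : realType) (k : R)
    (W : R.-pker (measurableTypeR R * int) ~> int) (a b : \bar R) :
  0 <= k -> symmetric_walk k W -> (1 <= a)%E -> (0 <= b <= 1)%E ->
  (fun t : R => ((t^-1)%:E * lne (walk_moment W a b t))%E) @ +oo -->
  (ereal_sup [set (x%:E * lne a - rate k x)%E | x in [set x : R | (0 <= x)%R]]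
   - ereal_inf [set rate k x | x in [set x : R | (0 <= x)%R]])%E.
Proof.
move=> k0 walkW a1 /andP[b0 b1]; rewrite ereal_inf_rate// sube0.
case: a a1 => [lam|_|//]; last first.
  rewrite ereal_sup_rate_pinfty//; case: ifPn => [/eqP kE|kn].
    apply: cvg_near_cst; near=> t.
    have t0 : 0 < t by near: t; exact: nbhs_pinfty_gt.
    by rewrite (walk_moment_frozen k0 walkW)// ?(ltW t0)// lne1 mule0.
  have kp : 0 < k by rewrite lt_def kn.
  apply: cvg_near_cst; near=> t.
  have t0 : 0 < t by near: t; exact: nbhs_pinfty_gt.
  by rewrite (walk_moment_pinfty k0 walkW)//= gt0_muley// lte_fin invr_gt0.
rewrite lee_fin => lam1; rewrite ereal_sup_rate_fin//.
have lam0 : 0 < lam by exact: lt_le_trans lam1.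
case: b b0 b1 => [b|//|//]; rewrite !lee_fin => b0 b1.
have b01 : 0 <= b <= 1 by rewrite b0.
have l01 : 0 <= lam^-1 <= 1 by rewrite invr_ge0 (ltW lam0) invf_le1.
pose V t := walk_moment W lam%:E b%:E t.
have Vb t : 0 < t -> [/\ V t \is a fin_num,
    expR (walk_exponent k lam * t) <= 2 * fine (V t) &
    fine (V t) <= 2 * expR (walk_exponent k lam * t)].
  move=> t0.
  have := walk_moment_comparable W t lam1 b01 (proj1 (andP l01)).
  have := walk_moment_comparable W t lam1 l01 b0.
  rewrite -/(V t) (walk_moment_inv k0 walkW lam1 (ltW t0)) => lo up.
  have fV : V t \is a fin_num.
    rewrite ge0_fin_numE; first by rewrite (le_lt_trans up)// -EFinM ltry.
    rewrite /V /walk_moment adde_ge0//; apply: integral_ge0 => n _.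
    by rewrite adde_ge0// expe_ge0// lee_fin ltW.
  by split=> //; rewrite -lee_fin EFinM fineK.
have VE t : 0 < t -> ((t^-1)%:E * lne (V t))%E = (t^-1 * ln (fine (V t)))%:E.
  move=> t0; have [fV lo _] := Vb t t0.
  have v0 : 0 < fine (V t).
    by rewrite -(pmulr_rgt0 _ (ltr0n R 2)) (lt_le_trans (expR_gt0 _) lo).
  by rewrite -{1}(fineK fV) lne_EFin// -EFinM.
apply: cvg_EFin.
  near=> t; have t0 : 0 < t by near: t; exact: nbhs_pinfty_gt.
  by rewrite /= -/(V t) VE.
have := @cvg_ln_div_exp_bounds R (fine \o V) (walk_exponent k lam).
move=> H; apply: cvg_trans (H _); last by move=> t t0; have [] := Vb t t0.
apply: near_eq_cvg; near=> t.
have t0 : 0 < t by near: t; exact: nbhs_pinfty_gt.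
by rewrite /= -/(V t) VE.
Unshelve. all: by end_near. Qed.

Theorem proposition6p6 (R : realType) (sigma k : R)
    (mu : probability (measurableTypeR R) R)
    (Q : probability (config R) R)
    (P : R.-pker (measurableTypeR R * config R) ~> config R)
    (W : R.-pker (measurableTypeR R * int) ~> int) :
  0 < sigma -> 0 <= k ->
  mu [set y : R | 0 <= y] = 1%E ->
  is_product_measure mu Q ->
  is_abep sigma k P ->
  symmetric_walk k W ->
  let lambda_p := exp_moment mu (2 * sigma) in
  let lambda_m := exp_moment mu (- (2 * sigma)) in
  (forall (i : int) (t : R), 0 <= t ->
     (forall x : config R, nonneg_config x ->
        cvgn (fun L => current_exp_finite sigma P i t (restriction L x))) /\
     current_exp_product sigma P Q i t =
     (W (t, 0%R) [set 0%R] +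
      \int[W (t, 0%R)]_(n in [set n : int | (1 <= n)%R])
         (lambda_p ^+ `|n|%N + lambda_m ^+ `|n|%N))%E) /\
  (forall i : int,
     (fun t : R => ((t^-1)%:E * lne (current_exp_product sigma P Q i t))%E)
       @ +oo -->
     (ereal_sup [set (x%:E * lne lambda_p - rate k x)%E | x in [set x : R | (0 <= x)%R]]
      - ereal_inf [set rate k x | x in [set x : R | (0 <= x)%R]])%E).
Proof.
move=> sigma0 k0 mu1 muQ abepP walkW lambda_p lambda_m; split=> [i t t0|i].
  split=> [x x0|].
    by apply/cvg_ex; eexists; exact: (current_exp_finite_cvg sigma0 k0 abepP walkW).
  exact: (current_exp_productE sigma0 k0 mu1 muQ abepP walkW).
(* Since [mu] lives on the nonnegative half-line, the two bases lie on opposite sides of 1, as the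
   asymptotics require. *)
have lm01 : (0 <= lambda_m <= 1)%E.
  by rewrite exp_moment_ge0 exp_moment_le1// oppr_le0 mulr_ge0// ltW.
have lp1 : (1 <= lambda_p)%E by rewrite exp_moment_ge1// mulr_ge0// ltW.
have := walk_moment_log_cvg k0 walkW lp1 lm01; apply: cvg_trans.
apply: near_eq_cvg; near=> t.
have t0 : 0 <= t by near: t; exact: nbhs_pinfty_ge.
by rewrite (current_exp_productE sigma0 k0 mu1 muQ abepP walkW).
Unshelve. all: by end_near. Qed.
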